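(* Let $N\ge 2$, let $\pi_1,\pi_2,\pi_3,\dots$ be the Toda hierarchy of Poisson tensors in Flaschka coordinates $(a_1,\dots,a_{N-1},b_1,\dots,b_N)$, let $Y_j=D(\pi_j)$ be the modular vector field of $\pi_j$, and let $H_j=\frac1j\operatorname{tr}L^j$, where $L$ is the Jacobi matrix of the Toda lattice. Then for all integers $i,j\ge1$: a) $Y_i(H_j)=Y_j(H_i)$; b) $\mathcal{L}_{Y_i}\pi_j=-\mathcal{L}_{Y_j}\pi_i$, where $\mathcal{L}$ denotes the Lie derivative.
   Context: Coordinates on $\mathbb{R}^{2N-1}$: $(x_1,\dots,x_{2N-1})=(a_1,\dots,a_{N-1},b_1,\dots,b_N)$, with the convention $a_0=a_N=0$ (and terms containing variables of index outside the allowed range are zero). $L$ is the symmetric tridiagonal $N\times N$ matrix with $L_{ii}=b_i$, $L_{i,i+1}=L_{i+1,i}=a_i$, and other entries zero. A Poisson tensor $\pi$ is identified with its matrix $\pi_{ik}=\{x_i,x_k\}_\pi$. The modular vector field (with respect to the standard volume) of $\pi$ is $$D(\pi)=\sum_{k}\Big(\sum_{i}\frac{\partial\pi_{ki}}{\partial x_i}\Big)\frac{\partial}{\partial x_k}.$$ The Toda hierarchy $\pi_j$: - $\pi_1$ is given by $\{a_i,b_i\}=-a_i$, $\{a_i,b_{i+1}\}=a_i$ ($1\le i\le N-1$), all other brackets of coordinates zero. - $\pi_2$ is given by $\{a_i,a_{i+1}\}=\tfrac12 a_ia_{i+1}$, $\{a_i,b_i\}=-a_ib_i$, $\{a_i,b_{i+1}\}=a_ib_{i+1}$,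 $\{b_i,b_{i+1}\}=2a_i^2$, all other brackets zero. - The higher tensors are obtained by Lie derivatives along master symmetries $X_1,X_2$: $\pi_3=-\mathcal{L}_{X_1}\pi_2$, $\pi_4=-\tfrac12\mathcal{L}_{X_2}\pi_2$, and $\pi_{j+1}=\tfrac{1}{j-3}\mathcal{L}_{X_1}\pi_j$ for $j\ge4$ (instances of the known relations $\mathcal{L}_{X_i}\pi_j=(j-i-2)\pi_{i+j}$). Here $X_1=\sum_{i=1}^{N-1}A_i\frac{\partial}{\partial a_i}+\sum_{i=1}^NB_i\frac{\partial}{\partial b_i}$ with $$A_i=-i\,a_ib_i+(i+2)a_ib_{i+1},\qquad B_i=(2i+3)a_i^2+(1-2i)a_{i-1}^2+b_i^2,$$ and $X_2=\sum_{i=1}^{N-1}C_i\frac{\partial}{\partial a_i}+\sum_{i=1}^ND_i\frac{\partial}{\partial b_i}$ with $$C_i=(2-i)a_{i-1}^2a_i+(1-i)a_ib_i^2+a_ib_ib_{i+1}+(i+1)a_ia_{i+1}^2+(i+1)a_ib_{i+1}^2+a_i^3+\Big(\sum_{k=1}^{i-1}b_k\Big)a_i(b_{i+1}-b_i),$$ $$D_i=2\Big(\sum_{k=1}^{i-1}b_k\Big)a_i^2-2\Big(\sum_{k=1}^{i-2}b_k\Big)a_{i-1}^2+(2i+2)a_i^2b_i+(2i+1)a_i^2b_{i+1}+(3-2i)a_{i-1}^2b_{i-1}+(4-2i)a_{i-1}^2b_i+b_i^3.$$ *)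

(* Defs.v *)
From mathcomp Require Import all_boot all_order all_algebra.
From mathcomp Require Import reals.
From mathcomp Require Export mpoly.

Set Implicit Arguments.
Unset Strict Implicit.
Unset Printing Implicit Defensive.

Import GRing.Theory.
Local Open Scope ring_scope.

(* Every function and tensor component below is polynomial in the
   coordinates, hence an element of {mpoly R[n]}, and p^`M(k) is its partial
   derivative with respect to the k-th coordinate.  Vector fields are the row
   vectors of their components; a bivector pi is the matrix of its brackets
   pi i k = {x_i, x_k}. *)

Section PolynomialTensors.
Variables (R : fieldType) (n : nat).
Implicit Types (X : 'rV[{mpoly R[n]}]_n) (pi : 'M[{mpoly R[n]}]_n).

Definition vf_apply X (f : {mpoly R[n]}) : {mpoly R[n]} :=
  \sum_(k < n) X ord0 k * f^`M(k).

(* (L_X pi)(f, g) = X (pi (f, g)) - pi (X f, g) - pi (f, X g) evaluated at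
   f = x_i and g = x_j. *)
Definition lie X pi : 'M[{mpoly R[n]}]_n :=
  \matrix_(i, j) (vf_apply X (pi i j)
                  - \sum_(k < n) (X ord0 i)^`M(k) * pi k j
                  - \sum_(k < n) (X ord0 j)^`M(k) * pi i k).

Definition modular_vf pi : 'rV[{mpoly R[n]}]_n :=
  \row_k \sum_(i < n) (pi k i)^`M(i).

End PolynomialTensors.

Section Toda.
Variables (R : fieldType) (N : nat).

(* 2N - 1, for N > 0; the first N.-1 coordinates are the a_i, the last N ones
   the b_i. *)
Definition toda_dim : nat := N.-1 + N.

Notation P := {mpoly R[toda_dim]}.

(* Flaschka coordinates with the 1-based indices 1 <= i <= N - 1 for a and
   1 <= i <= N for b; they are 0 for any other index.  An ordinal i (which is
   0-based) in the first or second summand of the index type stands for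
   a_{i+1} or b_{i+1}. *)
Definition fa (i : nat) : P :=
  if i is i'.+1 then oapp (fun k : 'I_N.-1 => 'X_(lshift N k)) 0 (insub i')
  else 0.

Definition fb (i : nat) : P :=
  if i is i'.+1 then oapp (fun k : 'I_N => 'X_(rshift N.-1 k)) 0 (insub i')
  else 0.

Definition jacobi_mx : 'M[P]_N :=
  \matrix_(i, j)
    if (i : nat) == j then fb i.+1
    else if j == i.+1 :> nat then fa i.+1
    else if i == j.+1 :> nat then fa j.+1
    else 0.

Definition toda_H (j : nat) : P := (j%:R^-1)%:MP * \tr (jacobi_mx ^+ j).

Definition toda_vf (A B : nat -> P) : 'rV[P]_toda_dim :=
  \row_k match split k with inl i => A i.+1 | inr i => B i.+1 end.

(* The skew-symmetric matrix whose brackets are those listed by u, each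
   nonzero bracket being listed in only one of its two orders. *)
Definition skew_of (u : 'I_N.-1 + 'I_N -> 'I_N.-1 + 'I_N -> P) :
    'M[P]_toda_dim :=
  \matrix_(k, l) (u (split k) (split l) - u (split l) (split k)).

Definition toda1 : 'M[P]_toda_dim :=
  skew_of (fun x y =>
    match x, y with
    | inl i, inr j =>
        if j == i :> nat then - fa i.+1
        else if j == i.+1 :> nat then fa i.+1
        else 0
    | _, _ => 0
    end).

Definition toda2 : 'M[P]_toda_dim :=
  skew_of (fun x y =>
    match x, y with
    | inl i, inl j =>
        if j == i.+1 :> nat then (2%:R^-1)%:MP * (fa i.+1 * fa i.+2) else 0
    | inl i, inr j =>
        if j == i :> nat then - (fa i.+1 * fb i.+1)
        else if j == i.+1 :> nat then fa i.+1 * fb i.+2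
        else 0
    | inr i, inr j =>
        if j == i.+1 :> nat then 2%:R * fa i.+1 ^+ 2 else 0
    | inr _, inl _ => 0
    end).

Definition X1 : 'rV[P]_toda_dim :=
  toda_vf
    (fun i => - i%:R * fa i * fb i + (i%:R + 2%:R) * fa i * fb i.+1)
    (fun i => (2%:R * i%:R + 3%:R) * fa i ^+ 2
              + (1 - 2%:R * i%:R) * fa i.-1 ^+ 2 + fb i ^+ 2).

Definition X2 : 'rV[P]_toda_dim :=
  toda_vf
    (fun i => (2%:R - i%:R) * fa i.-1 ^+ 2 * fa i
              + (1 - i%:R) * fa i * fb i ^+ 2
              + fa i * fb i * fb i.+1
              + (i%:R + 1) * fa i * fa i.+1 ^+ 2
              + (i%:R + 1) * fa i * fb i.+1 ^+ 2
              + fa i ^+ 3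
              + (\sum_(1 <= k < i) fb k) * fa i * (fb i.+1 - fb i))
    (fun i => 2%:R * (\sum_(1 <= k < i) fb k) * fa i ^+ 2
              - 2%:R * (\sum_(1 <= k < i.-1) fb k) * fa i.-1 ^+ 2
              + (2%:R * i%:R + 2%:R) * fa i ^+ 2 * fb i
              + (2%:R * i%:R + 1) * fa i ^+ 2 * fb i.+1
              + (3%:R - 2%:R * i%:R) * fa i.-1 ^+ 2 * fb i.-1
              + (4%:R - 2%:R * i%:R) * fa i.-1 ^+ 2 * fb i
              + fb i ^+ 3).

(* The value at 0 is junk.  In the last case j'.+1 is the index j + 1 with
   j = j' >= 4. *)
Fixpoint toda (j : nat) : 'M[P]_toda_dim :=
  match j with
  | 0 => 0
  | 1 => toda1
  | 2 => toda2
  | 3 => - lie X1 toda2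
  | 4 => (- 2%:R^-1)%:MP *: lie X2 toda2
  | j'.+1 => ((j'%:R - 3%:R)^-1)%:MP *: lie X1 (toda j')
  end.

Definition toda_Y (j : nat) : 'rV[P]_toda_dim := modular_vf (toda j).

End Toda.

(* Main.v *)
Require Import Defs.
From HB Require Import structures.
From mathcomp Require Import all_boot all_order all_algebra.
From mathcomp Require Import reals.
From mathcomp Require Import ring zify.

Set Implicit Arguments.
Unset Strict Implicit.
Unset Printing Implicit Defensive.

Import Order.TTheory GRing.Theory Num.Theory.
Local Open Scope ring_scope.

(** Write s_k for the k-th coordinate if it is one of the a_i, and s_k = 1 if it
  is one of the b_i.  All tensors of the hierarchy are logarithmic along a = 0:
  a field has components s_k xi_k and a bivector has entries s_k s_l p_kl with
  xi and p polynomial.  The derivations s_k d/dx_k commute, so the logarithmic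
  components xi, p obey the same formulas for Lie derivatives and Schouten
  brackets as components in coordinates do.  Two facts make this frame useful.

  Restriction to a = 0 commutes with the derivations of the frame, hence with
  every tensor operation ([logd_res], [res_flie], [res_schouten]).

  The Toda flow chi, given by a_i' = a_i (b_{i+1} - b_i) and
  b_i' = 2 (a_i^2 - a_{i-1}^2), multiplies a monomial a^nu, to lowest order in a,
  by the linear form sum_i nu_i (b_{i+1} - b_i), which is nonzero for nu <> 0.
  So a logarithmic tensor that is invariant under chi and vanishes on a = 0 has
  infinite order of vanishing there, that is, it is zero ([rigid1], [rigid2],
  [rigid3]): an identity between chi-invariant tensors can be checked on a = 0.

  All pi_j are chi-invariant.  The brackets chi4 = [X1, chi] and
  chi5 = [X2, chi] are the next Toda flows and commute with chi.  If pi is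
  invariant, then L_chi L_X1 pi = - L_chi4 pi, and L_chi4 pi is again invariant
  and vanishes on a = 0, so it is zero; likewise for X2 ([commuting_field_inv],
  [flie_preserves_inv], [log_toda_level]).

  On a = 0 the logarithmic brackets of pi_j are {b, b} = 0, {a_i, b_k} =
  (delta_{k,i+1} - delta_{k,i}) b_k^{j-1}, and {a_i, a_k} is the mixed second
  difference of a skew kernel G(i, k) that depends on b_i and b_k only.  This
  shape survives the Lie derivatives along X1 and X2 ([has_nf_flie]), and any
  two bivectors of this shape have Schouten bracket zero ([schouten_nf]).  Hence
  [pi_i, pi_j] = 0 for all i and j ([log_toda_compatible]).

  Part b) is the divergence of this equation, since the divergence of the
  Schouten bracket is, up to sign, L_{Y_i} pi_j + L_{Y_j} pi_i
  ([flie_modular]).  For part a), Y_i(H_j) is minus the divergence of the field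
  pi_i dH_j.  This field is chi-invariant because chi is isospectral, and on
  a = 0 it is the field with logarithmic components
  b_{k+1}^{i+j-2} - b_k^{i+j-2}, symmetric in i and j; so
  pi_i dH_j = pi_j dH_i ([ham_sym]). *)

(** * Tensor calculus in a frame of commuting derivations *)

Section Frame.
Variables (P : comNzRingType) (n : nat) (e : 'I_n -> {additive P -> P}).
Hypothesis eM : forall k f g, e k (f * g) = e k f * g + f * e k g.
Hypothesis eC : forall k l f, e k (e l f) = e l (e k f).
Implicit Types (X Y : 'rV[P]_n) (p q : 'M[P]_n) (f g : P).

Definition act X f : P := \sum_k X ord0 k * e k f.

Lemma act_is_additive X : zmod_morphism (act X).
Proof.
by move=> f g; rewrite /act -sumrB; apply: eq_bigr => k _; rewrite raddfB mulrBr.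
Qed.
HB.instance Definition _ X := GRing.isZmodMorphism.Build P P (act X) (act_is_additive X).

Lemma actM X f g : act X (f * g) = act X f * g + f * act X g.
Proof.
rewrite /act big_distrl big_distrr -big_split /=; apply: eq_bigr => k _.
by rewrite eM; ring.
Qed.

(** The Lie derivative of a bivector in matrix form: X(p) - J p - p J^T for the
  Jacobian J of X. *)
Definition jac X : 'M[P]_n := \matrix_(i, k) e k (X ord0 i).
Definition br X Y : 'rV[P]_n := \row_i (act X (Y ord0 i) - act Y (X ord0 i)).
Definition flie X p : 'M[P]_n := map_mx (act X) p - jac X *m p - p *m (jac X)^T.

Lemma flieE X p i j : flie X p i j = act X (p i j)
  - \sum_k e k (X ord0 i) * p k j - \sum_k e k (X ord0 j) * p i k.
Proof.
rewrite /flie !mxE; congr (_ - _ - _); apply: eq_bigr => k _; rewrite !mxE //.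
exact: mulrC.
Qed.

Lemma skewE p : p^T = - p -> forall i j, p i j = - p j i.
Proof. by move=> pT i j; have := congr1 (fun Z : 'M[P]_n => Z j i) pT; rewrite !mxE. Qed.

Lemma flie_is_additive X : zmod_morphism (flie X).
Proof.
by move=> p q; rewrite /flie map_mxB mulmxBr mulmxBl !opprB;
   apply/matrixP => i j; rewrite !mxE; ring.
Qed.
HB.instance Definition _ X :=
  GRing.isZmodMorphism.Build _ _ (flie X) (flie_is_additive X).

Lemma flieZ X c p : (forall k, e k c = 0) -> flie X (c *: p) = c *: flie X p.
Proof.
move=> ec; rewrite /flie -scalemxAr -scalemxAl !scalerBr; congr (_ - _ - _).
apply/matrixP => i j; rewrite !mxE actM /act big1 ?mul0r ?add0r // => k _.
by rewrite ec mulr0.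
Qed.

Lemma flieDl X Y p : flie (X + Y) p = flie X p + flie Y p.
Proof.
apply/matrixP => i j; rewrite [RHS]mxE !flieE.
have -> : act (X + Y) (p i j) = act X (p i j) + act Y (p i j).
  by rewrite /act -big_split; apply: eq_bigr => k _; rewrite mxE mulrDl.
have E a (w : 'I_n -> P) : \sum_k e k ((X + Y) ord0 a) * w k
    = \sum_k e k (X ord0 a) * w k + \sum_k e k (Y ord0 a) * w k.
  by rewrite -big_split; apply: eq_bigr => k _; rewrite mxE raddfD mulrDl.
by rewrite !E; ring.
Qed.

Lemma flie_tr X p : (flie X p)^T = flie X p^T.
Proof.
apply/matrixP => i j; rewrite [LHS]mxE !flieE mxE addrAC.
by congr (_ - _ - _); apply: eq_bigr => k _; rewrite mxE.
Qed.

Lemma map_act_mul X m1 m2 m3 (A : 'M[P]_(m1, m2)) (B : 'M[P]_(m2, m3)) :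
  map_mx (act X) (A *m B) = map_mx (act X) A *m B + A *m map_mx (act X) B.
Proof.
apply/matrixP => i j; rewrite !mxE raddf_sum -big_split /=.
by apply: eq_bigr => k _; rewrite !mxE actM.
Qed.

Lemma act_e X k f : act X (e k f) = e k (act X f) - \sum_l e k (X ord0 l) * e l f.
Proof.
rewrite {2}/act raddf_sum -sumrB; apply: eq_bigr => l _.
by rewrite eM eC; ring.
Qed.

Lemma act_br X Y f : act (br X Y) f = act X (act Y f) - act Y (act X f).
Proof.
have E (Z W : 'rV[P]_n) : act Z (act W f) = \sum_k act Z (W ord0 k) * e k f
   + \sum_k \sum_l W ord0 k * Z ord0 l * e l (e k f).
  rewrite {1}[act W f]/act raddf_sum -big_split; apply: eq_bigr => k _ /=.
  rewrite actM; congr (_ + _); rewrite /act big_distrr; apply: eq_bigr => l _ /=.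
  by rewrite mulrA.
rewrite !E opprD addrACA -sumrB [X in _ + X](_ : _ = 0) ?addr0.
  by apply: eq_bigr => k _; rewrite mxE mulrBl.
apply/eqP; rewrite subr_eq0; apply/eqP; rewrite exchange_big /=.
by apply: eq_bigr => k _; apply: eq_bigr => l _; rewrite eC; ring.
Qed.

Lemma jac_br X Y : jac (br X Y) =
  map_mx (act X) (jac Y) - map_mx (act Y) (jac X) + jac Y *m jac X - jac X *m jac Y.
Proof.
have E (Z W : 'rV[P]_n) a b : (jac Z *m jac W) a b
    = \sum_l e b (W ord0 l) * e l (Z ord0 a).
  by rewrite mxE; apply: eq_bigr => l _; rewrite !mxE mulrC.
have D (A B : 'M[P]_n) a b : (A + B) a b = A a b + B a b by rewrite mxE.
have N (A : 'M[P]_n) a b : (- A) a b = - A a b by rewrite mxE.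
apply/matrixP => i k; rewrite !(D, N, E) !mxE !act_e raddfB; ring.
Qed.

(** With J_[X,Y] = X(J_Y) - Y(J_X) + J_Y J_X - J_X J_Y, this is a computation in
  the noncommutative ring of matrices. *)
Lemma flie_br X Y p : flie (br X Y) p = flie X (flie Y p) - flie Y (flie X p).
Proof.
have -> : flie (br X Y) p = map_mx (act (br X Y)) p - jac (br X Y) *m p
   - p *m (jac (br X Y))^T by [].
have -> : map_mx (act (br X Y)) p
   = map_mx (act X) (map_mx (act Y) p) - map_mx (act Y) (map_mx (act X) p).
  by apply/matrixP => i j; rewrite !mxE act_br.
rewrite jac_br /flie !map_mxB !map_act_mul -!map_trmx.
have tB (A B : 'M[P]_n) : (A - B)^T = A^T - B^T by rewrite raddfB.
have tD (A B : 'M[P]_n) : (A + B)^T = A^T + B^T by rewrite raddfD.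
rewrite !(tB, tD, trmx_mul) !(mulmxBl, mulmxBr, mulmxDl, mulmxDr) !mulmxA.
move: (map_mx _ (map_mx _ _)) (map_mx _ (map_mx _ _)) => A1 A2.
move: (_ *m _ *m _) => A3; move: (_ *m _ *m _) => A4.
by rewrite !opprB !opprD !opprK; apply/matrixP => i j; rewrite !mxE; ring.
Qed.

Lemma flie0l p : flie 0 p = 0.
Proof. by have := flieDl 0 0 p; rewrite addr0 -{1}[flie 0 p]addr0 => /addrI. Qed.

Lemma flie_comm0 X Y p : br X Y = 0 -> flie X p = 0 -> flie X (flie Y p) = 0.
Proof.
move=> comm inv; have := flie_br X Y p.
by rewrite comm inv flie0l [flie Y 0]raddf0 subr0.
Qed.

Lemma flie_flie0 X Y p : flie X p = 0 -> flie (br Y X) p = 0 -> flie X (flie Y p) = 0.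
Proof.
move=> inv invZ; have := flie_br Y X p.
by rewrite invZ inv [flie Y 0]raddf0 sub0r => /eqP; rewrite eq_sym oppr_eq0 => /eqP.
Qed.

(** Row k of p is the Hamiltonian field of a k-th coordinate, so this is, up to
  sign, the slice of the Schouten bracket of p and q at that coordinate. *)
Definition schouten p q k : 'M[P]_n := flie (row k p) q + flie (row k q) p.

Lemma schoutenE p q k i j :
  schouten p q k i j = flie (row k p) q i j + flie (row k q) p i j.
Proof. by rewrite [LHS]mxE. Qed.

Lemma flie_scale_sum (V : 'M[P]_n) (c : 'I_n -> P) q i j :
  flie (\sum_l c l *: row l V) q i j = \sum_l c l * flie (row l V) q i j
   - \sum_l \sum_m e m (c l) * V l i * q m j
   - \sum_l \sum_m e m (c l) * V l j * q i m.
Proof.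
have cE u : (\sum_l c l *: row l V) ord0 u = \sum_l c l * V l u.
  by rewrite summxE; apply: eq_bigr => l _; rewrite !mxE.
have jE u m : e m ((\sum_l c l *: row l V) ord0 u)
   = \sum_l c l * e m (V l u) + \sum_l e m (c l) * V l u.
  rewrite cE raddf_sum -big_split; apply: eq_bigr => l _ /=.
  by rewrite eM addrC.
rewrite flieE.
have -> : \sum_l c l * flie (row l V) q i j = \sum_l (c l * act (row l V) (q i j)
  - \sum_m c l * e m (V l i) * q m j - \sum_m c l * e m (V l j) * q i m).
  apply: eq_bigr => l _; rewrite flieE !mulrBr !big_distrr; congr (_ - _ - _);
  by apply: eq_bigr => m _ /=; rewrite mxE mulrA.
rewrite !sumrB.
have -> : act (\sum_l c l *: row l V) (q i j) = \sum_l c l * act (row l V) (q i j).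
  rewrite /act; under eq_bigr => m _ do rewrite cE big_distrl /=.
  rewrite exchange_big; apply: eq_bigr => l _; rewrite big_distrr /=.
  by apply: eq_bigr => m _; rewrite mxE mulrA.
have split3 u (w : 'I_n -> P) : \sum_m e m ((\sum_l c l *: row l V) ord0 u) * w m
   = \sum_l \sum_m c l * e m (V l u) * w m + \sum_l \sum_m e m (c l) * V l u * w m.
  under eq_bigr => m _ do rewrite jE mulrDl !big_distrl /=.
  by rewrite big_split /=; congr (_ + _); rewrite exchange_big.
by rewrite !split3; ring.
Qed.

(** If p is invariant, then [X, V_k] is the Hamiltonian field of the component X_k,
  where V_k is row k of p. *)
Lemma br_row (X : 'rV[P]_n) p k : flie X p = 0 ->
  br X (row k p) = \sum_l jac X k l *: row l p.
Proof.
move=> inv; apply/rowP => i.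
have := congr1 (fun A : 'M[P]_n => A k i) inv; rewrite /= flieE mxE => E.
rewrite !mxE summxE.
have -> : act (row k p) (X ord0 i) = \sum_l e l (X ord0 i) * p k l.
  by apply: eq_bigr => l _; rewrite mxE mulrC.
have -> : act X (p k i) - \sum_l e l (X ord0 i) * p k l = \sum_l e l (X ord0 k) * p l i.
  by move/eqP: E; rewrite addrAC subr_eq0 => /eqP.
by apply: eq_bigr => l _; rewrite !mxE.
Qed.

(** Replacing [X, V_k] by sum_l J_kl V_l for the Hamiltonian fields V_l leaves
  the terms in which a derivative falls on J_kl = d_l X_k; they pair the Hessian
  of X_k, which is symmetric, with one row of p and one of q, and cancel against
  the same terms with p and q exchanged. *)
Lemma flie_schouten X p q k : p^T = - p -> q^T = - q -> flie X p = 0 -> flie X q = 0 ->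
  flie X (schouten p q k) = \sum_l jac X k l *: schouten p q l.
Proof.
move=> pT qT invp invq; rewrite /schouten raddfD /=.
have aux r s : flie X r = 0 -> flie X s = 0 ->
    flie X (flie (row k r) s) = flie (\sum_l jac X k l *: row l r) s.
  move=> ir is_; have := flie_br X (row k r) s.
  by rewrite is_ [flie (row k r) 0]raddf0 subr0 => <-; rewrite br_row.
rewrite !aux //; apply/matrixP => i j; rewrite [LHS]mxE !flie_scale_sum summxE.
under [RHS]eq_bigr => l _ do rewrite mxE schoutenE mulrDr.
rewrite big_split /=.
set A := \sum_l _ * flie _ q _ _; set B := \sum_l _ * flie _ p _ _.
pose h l m := e m (e l (X ord0 k)).
have hS l m : h l m = h m l by rewrite /h eC.
have sw (r s : 'M[P]_n) : r^T = - r -> s^T = - s -> forall a b,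
   \sum_l \sum_m e m (jac X k l) * r l a * s m b
   = - \sum_l \sum_m e m (jac X k l) * s l b * r a m.
  move=> rT sT a b; rewrite exchange_big -sumrN; apply: eq_bigr => m _ /=.
  rewrite -sumrN; apply: eq_bigr => l _; rewrite !mxE -/(h l m) -/(h m l) hS (skewE rT l a).
  by ring.
rewrite !(sw _ _ pT qT) !(sw _ _ qT pT).
by ring.
Qed.

(** L_X p evaluated on x_i and x_j, in terms of Hamiltonian fields: this is the
  form in which the Lie derivative is computed on the explicit tensors. *)
Lemma flie_skewE X p i j : p^T = - p -> flie X p i j =
  act X (p i j) + act (row j p) (X ord0 i) - act (row i p) (X ord0 j).
Proof.
move=> pT; rewrite flieE /act; congr (_ + _ - _); last first.
  by apply: eq_bigr => k _; rewrite mxE mulrC.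
rewrite -sumrN; apply: eq_bigr => k _; rewrite mxE.
by rewrite (skewE pT j k) mulNr mulrC.
Qed.

Definition ham p f : 'rV[P]_n := \row_i \sum_k p i k * e k f.

Lemma br_ham X p f : flie X p = 0 -> act X f = 0 -> br X (ham p f) = 0.
Proof.
move=> inv Xf; apply/rowP => i; rewrite !mxE raddf_sum /=.
have E k : act X (p i k) = \sum_l e l (X ord0 i) * p l k + \sum_l e l (X ord0 k) * p i l.
  have := congr1 (fun A : 'M[P]_n => A i k) inv; rewrite /= flieE mxE.
  by move/eqP; rewrite -addrA -opprD subr_eq0 => /eqP.
under eq_bigr => k _ do rewrite actM E act_e Xf raddf0 sub0r.
under eq_bigr => k _ do rewrite mulrDl addrAC mulrN mulr_sumr !big_distrl /=.
rewrite /= {1}/act.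
under [X in _ - X]eq_bigr => k _ do rewrite mxE big_distrl /=.
rewrite !big_split /= sumrN.
set S1 := \sum_(i0 < n) \sum_(i1 < n) _; set S2 := \sum_(i0 < n) \sum_(i1 < n) _.
set S3 := \sum_(i0 < n) \sum_(i1 < n) _; set S4 := \sum_(i0 < n) \sum_(i1 < n) _.
have -> : S1 = S4.
  rewrite /S1 /S4 exchange_big; apply: eq_bigr => l _; apply: eq_bigr => k _ /=; ring.
have -> : S3 = S2.
  rewrite /S3 /S2 exchange_big; apply: eq_bigr => l _; apply: eq_bigr => k _ /=; ring.
by ring.
Qed.

Lemma brB X Y Z : br X (Y - Z) = br X Y - br X Z.
Proof.
apply/rowP => i; rewrite !mxE raddfB /=.
suff -> : act (Y - Z) (X ord0 i) = act Y (X ord0 i) - act Z (X ord0 i) by ring.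
by rewrite /act -sumrB; apply: eq_bigr => k _; rewrite !mxE mulrBl.
Qed.

Lemma hamE p f i : ham p f ord0 i = act (row i p) f.
Proof. by rewrite mxE; apply: eq_bigr => k _; rewrite mxE. Qed.

End Frame.

(** * Divergence and modular fields *)

Section FrameModular.
Variables (P : comNzRingType) (n : nat) (e : 'I_n -> {additive P -> P}).
Hypothesis eM : forall k f g, e k (f * g) = e k f * g + f * e k g.
Hypothesis eC : forall k l f, e k (e l f) = e l (e k f).
Implicit Types (X Y : 'rV[P]_n) (p q : 'M[P]_n) (f g : P).

Definition modular p : 'rV[P]_n := \row_k \sum_i e i (p k i).

Hypothesis two_free : forall x : P, x + x = 0 -> x = 0.

Lemma sum_skew_hess p f : p^T = - p -> \sum_c \sum_l p c l * e c (e l f) = 0.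
Proof.
move=> pT; apply: two_free; rewrite [X in X + _]exchange_big -big_split big1 // => l _.
rewrite -big_split big1 // => c _ /=.
by rewrite (skewE pT) eC mulNr addNr.
Qed.

Lemma div_skew p c : p^T = - p -> \sum_k e k (p k c) = - modular p ord0 c.
Proof.
move=> pT; rewrite mxE -sumrN; apply: eq_bigr => k _.
by rewrite (skewE pT) raddfN.
Qed.

Lemma act_modular p f : p^T = - p ->
  act e (modular p) f = - \sum_l e l (ham e p f ord0 l).
Proof.
move=> pT.
have -> : \sum_l e l (ham e p f ord0 l) = \sum_l \sum_k e l (p l k) * e k f
    + \sum_l \sum_k p l k * e l (e k f).
  rewrite -big_split; apply: eq_bigr => l _; rewrite mxE raddf_sum -big_split /=.
  by apply: eq_bigr => k _; rewrite eM.
rewrite sum_skew_hess // addr0 exchange_big -sumrN; apply: eq_bigr => k _ /=.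
by rewrite -big_distrl div_skew //= mulNr opprK.
Qed.

(** The part of the divergence of a Lie derivative that is not a Lie derivative
  along a divergence; it cancels in the symmetric sum below. *)
Let cross p q i j := \sum_c \sum_l e c (q i l) * e l (p c j).

Lemma div_act p q i j : p^T = - p ->
  \sum_c e c (act e (row i q) (p c j))
  = cross p q i j - act e (row i q) (modular p ord0 j).
Proof.
move=> pT.
have -> : \sum_c e c (act e (row i q) (p c j)) = cross p q i j
    + \sum_c \sum_l q i l * e l (e c (p c j)).
  rewrite -big_split; apply: eq_bigr => c _; rewrite raddf_sum -big_split /=.
  by apply: eq_bigr => l _; rewrite eM eC !mxE.
congr (_ + _); rewrite exchange_big -sumrN; apply: eq_bigr => l _ /=.
by rewrite -big_distrr -(raddf_sum (e l)) /= div_skew // raddfN mulrN !mxE.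
Qed.

Lemma div_flie_row p q i j : p^T = - p -> q^T = - q ->
  \sum_c e c (flie e (row c p) q i j)
  = - flie e (modular p) q i j + cross p q j i - cross p q i j.
Proof.
move=> pT qT; have E c := flie_skewE e (row c p) i j qT.
have -> : \sum_c e c (flie e (row c p) q i j) = \sum_c e c (act e (row c p) (q i j))
   + \sum_c e c (act e (row j q) (p c i)) - \sum_c e c (act e (row i q) (p c j)).
  rewrite -big_split /= -sumrB; apply: eq_bigr => c _ /=.
  by rewrite E raddfB raddfD !mxE.
rewrite !div_act // (flie_skewE e (modular p) i j qT).
have -> : \sum_c e c (act e (row c p) (q i j)) = - act e (modular p) (q i j).
  have -> : \sum_c e c (act e (row c p) (q i j))
     = \sum_c \sum_l e c (p c l) * e l (q i j) + \sum_c \sum_l p c l * e c (e l (q i j)).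
    rewrite -big_split; apply: eq_bigr => c _; rewrite raddf_sum -big_split /=.
    by apply: eq_bigr => l _; rewrite eM !mxE.
  rewrite sum_skew_hess // addr0 exchange_big -sumrN; apply: eq_bigr => l _ /=.
  by rewrite -big_distrl div_skew //= mulNr.
by ring.
Qed.

Lemma cross_swap p q i j : p^T = - p -> q^T = - q -> cross p q j i = cross q p i j.
Proof.
move=> pT qT; rewrite /cross exchange_big; apply: eq_bigr => l _; apply: eq_bigr => c _ /=.
by rewrite (skewE pT) (skewE qT j) !raddfN mulrNN mulrC.
Qed.

(** The divergence generates the Schouten bracket. *)
Lemma flie_modular p q : p^T = - p -> q^T = - q ->
  flie e (modular p) q + flie e (modular q) p
  = - \matrix_(i, j) \sum_c e c (schouten e p q c i j).
Proof.
move=> pT qT; apply/matrixP => i j; rewrite [LHS]mxE [RHS]mxE [in RHS]mxE.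
have -> : \sum_c e c (schouten e p q c i j) = \sum_c e c (flie e (row c p) q i j)
    + \sum_c e c (flie e (row c q) p i j).
  by rewrite -big_split; apply: eq_bigr => c _; rewrite schoutenE raddfD.
rewrite !div_flie_row // (cross_swap i j pT qT) (cross_swap j i pT qT); ring.
Qed.

End FrameModular.

(** * The logarithmic frame *)

Section Toda.
Variables (R : numFieldType) (M : nat).
Notation n := (M + M.+1)%N.
Notation P := {mpoly R[n]}.

Definition va (i : 'I_M) : 'I_n := lshift M.+1 i.
Definition vb (i : 'I_M.+1) : 'I_n := rshift M i.
Definition lo (i : 'I_M) : 'I_M.+1 := widen_ord (leqnSn M) i.
Definition hi (i : 'I_M) : 'I_M.+1 := lift ord0 i.

Definition lscale (k : 'I_n) : P := if (k < M)%N then 'X_k else 1.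
Definition logd_fun (k : 'I_n) (f : P) : P := lscale k * f^`M(k).

Lemma logd_fun_is_additive k : zmod_morphism (logd_fun k).
Proof. by move=> f g; rewrite /logd_fun mderivB mulrBr. Qed.
HB.instance Definition _ k :=
  GRing.isZmodMorphism.Build P P (logd_fun k) (logd_fun_is_additive k).

Definition logd (k : 'I_n) : {additive P -> P} := logd_fun k.

Arguments logd : simpl never.

Lemma logdE k f : logd k f = lscale k * f^`M(k). Proof. by []. Qed.

Lemma logdM k f g : logd k (f * g) = logd k f * g + f * logd k g.
Proof. by rewrite !logdE mderivM; ring. Qed.

Lemma logd_lscale k l : logd k (lscale l) = ((k == l) && (l < M)%N)%:R * lscale l.
Proof.
rewrite logdE /lscale; case: (ltnP l M) => lM; last by rewrite -mpolyC1 mderivC andbF mulr0 mul0r.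
rewrite andbT mderivX mnm1E eq_sym; have [->|_] := eqVneq k l; last first.
  by rewrite scale0r mulr0 mul0r.
rewrite lM scale1r mul1r; have -> : (U_(l) - U_(l) = 0)%MM.
  by apply/mnmP => i; rewrite mnmBE subnn mnm0E.
by rewrite mpolyX0 mulr1.
Qed.

Lemma logdC k l f : logd k (logd l f) = logd l (logd k f).
Proof.
have [->//|kl] := eqVneq k l.
have E a b g : a != b -> logd a (logd b g) = lscale b * logd a (g^`M(b)).
  move=> ab; rewrite [logd b g]logdE logdM logd_lscale (negbTE ab) /=; ring.
have lk : l != k by rewrite eq_sym.
by rewrite (E _ _ _ kl) (E _ _ _ lk) !logdE (mderiv_comm k l f); ring.
Qed.

Lemma mcoeffMXE (f : P) k m :
  ('X_k * f)@_m = if m k == 0%N then 0 else f@_(m - U_(k)).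
Proof.
have [mk|mk] := eqVneq.
  rewrite mulrC; apply/eqP; rewrite mcoeff_eq0; apply/negP.
  rewrite (perm_mem (msuppMX f U_(k))) => /mapP[m1 _ mE].
  by move: mk; rewrite mE mnmDE mnm1E eqxx.
have {1}-> : m = (U_(k) + (m - U_(k)))%MM; last by rewrite mulrC mcoeffMX.
apply/mnmP => i; rewrite mnmDE mnmBE mnm1E; case: eqP => [<-|_]; last by rewrite subn0.
by rewrite subnKC // lt0n.
Qed.

Lemma mcoeff_logd_a (i : 'I_n) f m : (i < M)%N -> (logd i f)@_m = f@_m *+ m i.
Proof.
move=> iM; rewrite logdE /lscale iM mcoeffMXE mcoeff_deriv; case: eqVneq => [->|mi] //.
rewrite mnmBE mnm1E eqxx subn1 prednK ?lt0n //; congr (_@_ _ *+ _).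
apply/mnmP => j; rewrite mnmDE mnmBE mnm1E; case: eqP => [<-|_]; last by rewrite subn0 addn0.
by rewrite subnK // lt0n.
Qed.

Lemma mcoeff_logd_b (i : 'I_n) f m : (M <= i)%N ->
  (logd i f)@_m = f@_(m + U_(i)) *+ (m i).+1.
Proof. by move=> iM; rewrite logdE /lscale ltnNge iM mul1r mcoeff_deriv. Qed.

(** * The order of vanishing along a = 0 *)

Definition adeg (m : 'X_{1..n}) : nat := \sum_(i < M) m (va i).
Definition aord d (f : P) := forall m, (adeg m < d)%N -> f@_m = 0.

Lemma adegD m1 m2 : adeg (m1 + m2) = (adeg m1 + adeg m2)%N.
Proof. by rewrite /adeg -big_split; apply: eq_bigr => i _; rewrite mnmDE. Qed.

Lemma adegU k : adeg U_(k) = (k < M)%N.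
Proof.
rewrite /adeg; case: ltnP => kM.
  rewrite (bigD1 (Ordinal kM)) //= big1 => [|i]; rewrite mnm1E.
    by rewrite addn0; case: eqP => // -[]; apply/val_inj.
  by move/eqP => ne; case: eqP => // kE; case: ne; apply/val_inj/esym/(congr1 val kE).
rewrite big1 // => i _; rewrite mnm1E; case: eqP => // kE.
by move: kM; rewrite kE leqNgt /= ltn_ord.
Qed.

Lemma aord0 d : aord d 0. Proof. by move=> m _; rewrite mcoeff0. Qed.
Lemma aordP0 f : aord 0 f. Proof. by []. Qed.
Lemma aordD d f g : aord d f -> aord d g -> aord d (f + g).
Proof. by move=> hf hg m hm; rewrite mcoeffD hf ?hg ?addr0. Qed.
Lemma aordN d f : aord d f -> aord d (- f).
Proof. by move=> hf m hm; rewrite mcoeffN hf ?oppr0. Qed.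
Lemma aordB d f g : aord d f -> aord d g -> aord d (f - g).
Proof. by move=> hf hg; apply/aordD/aordN. Qed.
Lemma aord_sum d (I : Type) (r : seq I) (Q : pred I) (F : I -> P) :
  (forall i, Q i -> aord d (F i)) -> aord d (\sum_(i <- r | Q i) F i).
Proof. by move=> h; elim/big_rec: _ => [|i f Qi]; [exact: aord0 | apply/aordD/h]. Qed.

Lemma aordM d1 d2 f g : aord d1 f -> aord d2 g -> aord (d1 + d2) (f * g).
Proof.
move=> hf hg m hm; rewrite mcoeffM big1 // => k /eqP mE.
move: (congr1 adeg mE) hm => ->; rewrite adegD; case: (ltnP (adeg k.1) d1) => [/hf ->|h1 h2].
  by rewrite mul0r.
by rewrite hg ?mulr0 // -(ltn_add2l d1); apply: leq_ltn_trans h2; rewrite leq_add2r.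
Qed.

Lemma aordMl d f g : aord d g -> aord d (f * g).
Proof. exact: (@aordM 0 d). Qed.
Lemma aordXa (i : 'I_n) : (i < M)%N -> aord 1 'X_i.
Proof.
move=> iM m; rewrite ltnS leqn0 => /eqP m0; rewrite mcoeffX; case: eqP => // mE.
by move: m0; rewrite -mE adegU iM.
Qed.

Lemma aord_logd d k f : aord d f -> aord d (logd k f).
Proof.
move=> hf m hm; case: (ltnP k M) => kM; first by rewrite mcoeff_logd_a // hf ?mul0rn.
by rewrite mcoeff_logd_b // hf ?mul0rn // adegD adegU [(k < M)%N]ltnNge kM addn0.
Qed.

(** The linear part of the Toda flow multiplies a^nu by the linear form
  sum_i nu_i (b_{i+1} - b_i).  If i0 is the least index with nu_i0 > 0, then b_i0
  occurs in that form with coefficient - nu_i0; comparing the coefficients of the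
  monomials of highest degree in b_i0 shows that multiplication by the form is
  injective, by descending induction on this degree. *)
Lemma aord_gain d f : (0 < d)%N -> aord d f ->
  aord d.+1 (\sum_i ('X_(vb (hi i)) - 'X_(vb (lo i))) * logd (va i) f) -> aord d.+1 f.
Proof.
move=> d0 hf h.
have vaM i : (va i < M)%N by rewrite /=.
(* c bounds the distance from the degree in b_i0 to the size of f. *)
have key c : forall m i0, adeg m = d -> (0 < m (va i0))%N ->
    (forall i, (0 < m (va i))%N -> (i0 <= i)%N) ->
    (msize f <= m (vb (lo i0)) + c)%N -> f@_m = 0.
  elim: c => [|c IH] m i0 dm m0 mmin hc.
    apply/eqP; rewrite mcoeff_eq0; apply: msize_mdeg_ge; apply: leq_trans hc _.
    by rewrite addn0 mdegE (bigD1 (vb (lo i0))) //= leq_addr.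
  pose x0 := vb (lo i0); pose m' := (m + U_(x0))%MM.
  have vaU (k : 'I_M.+1) i : U_(vb k)%MM (va i) = 0%N.
    by rewrite mnm1E eq_rlshift.
  have mU : (m' - U_(x0))%MM = m.
    by apply/mnmP => i; rewrite mnmBE mnmDE addnK.
  have vbM (k : 'I_M.+1) : (vb k < M)%N = false by rewrite /= ltnNge leq_addr.
  have other k i : k != lo i0 -> ('X_(vb k) * logd (va i) f)@_m' = 0.
    move=> kne; rewrite mcoeffMXE; case: eqP => // m'k; rewrite mcoeff_logd_a //.
    rewrite (IH _ i0) ?mul0rn //.
    - have : adeg m' = (adeg (m' - U_(vb k)) + adeg U_(vb k))%N.
        rewrite -adegD; congr adeg; apply/mnmP => j; rewrite mnmDE mnmBE mnm1E.
        case: eqP => [<-|]; last by rewrite subn0 addn0.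
        by rewrite subnK // lt0n; apply/eqP.
      by rewrite adegD !adegU !vbM dm !addn0.
    - by rewrite mnmBE mnmDE !vaU addn0 subn0.
    - by move=> j; rewrite mnmBE mnmDE !vaU addn0 subn0; apply: mmin.
    rewrite mnmBE mnmDE !mnm1E eqxx eq_shift (negbTE kne) subn0 addn1 addSn -addnS //.
  have := h m'; rewrite adegD adegU vbM dm addn0 ltnSn => /(_ isT).
  rewrite raddf_sum /= (bigD1 i0) //= big1 ?addr0 => [|i ii0].
    rewrite mulrBl mcoeffB other ?sub0r; last by rewrite -val_eqE /= /bump /=; lia.
    rewrite mcoeffMXE mnmDE mnm1E eqxx addn1 /= mU mcoeff_logd_a // => /eqP.
    by rewrite oppr_eq0 mulrn_eq0 eqn0Ngt m0 /= => /eqP.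
  rewrite mulrBl mcoeffB [X in _ - X]other ?subr0; last first.
    by apply: contra ii0 => /eqP /(congr1 val) /= E; apply/eqP/val_inj.
  have [hl|hl] := eqVneq (hi i) (lo i0); last exact: other.
  rewrite mcoeffMXE hl mnmDE mnm1E eqxx addn1 /= mU mcoeff_logd_a //.
  have [->|/mmin i0i] := posnP (m (va i)); first by rewrite mulr0n.
  exfalso; move/(congr1 val): hl i0i; rewrite /= /bump /=; lia.
move=> m; rewrite ltnS leq_eqVlt => /orP[/eqP dm|]; last exact: hf.
have /existsP[i mi] : [exists i, 0 < m (va i)]%N.
  rewrite -[X in is_true X]negbK negb_exists; apply/negP => /forallP z.
  move: d0; rewrite -dm /adeg big1 // => i _; apply/eqP.
  by have := z i; rewrite lt0n negbK.
case: (@arg_minnP _ i (fun i => (0 < m (va i))%N) val mi) => i0 mi0 min0.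
exact: (key (msize f) m i0 dm mi0 min0 (leq_addl _ _)).
Qed.

Lemma aord_all f : (forall d, aord d f) -> f = 0.
Proof. by move=> h; apply/mpolyP => m; rewrite mcoeff0 (h (adeg m).+1). Qed.

(** The hypotheses say that a member of the family gains one order of vanishing
  under chi modulo members of lower rank; by [aord_gain] it then gains one order
  itself, first in rank 0 and then upwards. *)
Lemma descent (chi : 'rV[P]_n) (I : Type) (F : I -> P) (r : I -> nat) :
  (forall i, chi ord0 (va i) = 'X_(vb (hi i)) - 'X_(vb (lo i))) ->
  (forall k, aord 1 (chi ord0 (vb k))) ->
  (forall d i, (forall j, aord d (F j)) ->
     (forall j, (r j < r i)%N -> aord d.+1 (F j)) -> aord d.+1 (act logd chi (F i))) ->
  (forall i, aord 1 (F i)) -> forall i, F i = 0.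
Proof.
move=> chia chib step F1 i; apply: aord_all => d.
elim: d i => [|d IH] i; first exact: aordP0.
(* Inner induction on the rank, at a fixed order d. *)
have [k] := ubnP (r i); elim: k i => // k IHk i; rewrite ltnS => rik.
case: d IH IHk => [|d] IH IHk; first exact: F1.
apply: aord_gain => //; have := step d.+1 i IH.
have lower j : (r j < r i)%N -> aord d.+2 (F j).
  by move=> rji; apply: IHk; apply: leq_trans rji rik.
move=> /(_ lower); rewrite /act big_split_ord /= => h.
have -> : \sum_(i0 < M) ('X_(vb (hi i0)) - 'X_(vb (lo i0))) * logd (va i0) (F i)
  = \sum_(i0 < M) chi ord0 (lshift M.+1 i0) * logd (lshift M.+1 i0) (F i).
  by apply: eq_bigr => j _; rewrite -chia.
rewrite -[X in aord _ X](addrK (\sum_(i0 < M.+1) chi ord0 (rshift M i0) * logd (rshift M i0) (F i))).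
apply: aordB => //; apply: aord_sum => j _.
by apply: (@aordM 1 d.+1); [exact: chib | exact: aord_logd].
Qed.

(** * Restriction to a = 0 *)

Definition res : P -> P :=
  mmap (@mpolyC n R) (fun k => if (k < M)%N then 0 else 'X_k).
HB.instance Definition _ := GRing.RMorphism.on res.

Lemma resD f g : res (f + g) = res f + res g. Proof. exact: rmorphD. Qed.
Lemma resB f g : res (f - g) = res f - res g. Proof. exact: rmorphB. Qed.
Lemma resN f : res (- f) = - res f. Proof. exact: rmorphN. Qed.
Lemma resM f g : res (f * g) = res f * res g. Proof. exact: rmorphM. Qed.
Lemma res_sum (I : Type) (r : seq I) (Q : pred I) (F : I -> P) :
  res (\sum_(i <- r | Q i) F i) = \sum_(i <- r | Q i) res (F i).
Proof. exact: rmorph_sum. Qed.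

Lemma mcoeff_res f m : (res f)@_m = if adeg m == 0%N then f@_m else 0.
Proof.
elim/mpolyind: f => [|c m' f _ _ IH]; first by rewrite raddf0 mcoeff0 if_same.
rewrite rmorphD /= !mcoeffD {}IH -mul_mpolyC rmorphM /= /res mmapC !mcoeffCM mmapX.
rewrite mcoeffX; have [am'|am'] := eqVneq (adeg m') 0%N.
  have -> : mmap1 (fun k : 'I_n => if (k < M)%N then 0 else 'X_k) m' = 'X_[m'] :> P.
    rewrite -(mmap1_id R m'); apply: eq_bigr => k _; case: ltnP => // kM.
    suff -> : m' k = 0%N by rewrite !expr0.
    move/eqP: am'; rewrite /adeg sum_nat_eq0 => /forallP /(_ (Ordinal kM)) /eqP <-.
    by congr (m' _); apply/val_inj.
  rewrite mcoeffX; case: (eqVneq m' m) => [<-|_]; first by rewrite am' mulr1.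
  by rewrite mulr0 !add0r.
have -> : mmap1 (fun k : 'I_n => if (k < M)%N then 0 else 'X_k) m' = 0 :> P.
  have /existsP[i mi] : [exists i : 'I_M, m' (va i) != 0%N].
    by move: am'; rewrite /adeg sum_nat_eq0 negb_forall.
  by rewrite /mmap1 (bigD1 (va i)) //= ltn_ord expr0n (negbTE mi) mul0r.
rewrite mcoeff0 mulr0 add0r; case: (eqVneq m' m) => [mE|_]; last by rewrite mulr0 add0r.
by rewrite -mE (negbTE am').
Qed.

Lemma aord1_res f : res f = 0 -> aord 1 f.
Proof.
move=> h m; rewrite ltnS leqn0 => m0; have := mcoeff_res f m.
by rewrite h mcoeff0 m0 /= => <-.
Qed.

(** This fails for d/da_i; it is the reason for the logarithmic frame. *)
Lemma logd_res k f : logd k (res f) = res (logd k f).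
Proof.
apply/mpolyP => m; rewrite mcoeff_res; case: (ltnP k M) => kM.
  by rewrite !mcoeff_logd_a // mcoeff_res; case: ifP => // _; rewrite mul0rn.
rewrite !mcoeff_logd_b // mcoeff_res adegD adegU [(k < M)%N]ltnNge kM addn0.
by case: ifP => // _; rewrite mul0rn.
Qed.

Lemma logd_res_a i f : logd (va i) (res f) = 0.
Proof.
apply/mpolyP => m; rewrite mcoeff_logd_a ?(ltn_ord i) // mcoeff0 mcoeff_res.
case: eqP => [|_]; last by rewrite mul0rn.
move/eqP; rewrite /adeg sum_nat_eq0 => /forallP /(_ i) /eqP ->.
by rewrite mulr0n.
Qed.

Lemma res_act X f : res (act logd X f) = act logd (map_mx res X) (res f).
Proof.
by rewrite /act rmorph_sum; apply: eq_bigr => k _; rewrite rmorphM /= mxE logd_res.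
Qed.

Lemma res_flie X p : map_mx res (flie logd X p) = flie logd (map_mx res X) (map_mx res p).
Proof.
apply/matrixP => i j; rewrite [LHS]mxE.
apply: eq_trans (congr1 res (flieE logd X p i j)) _.
apply: eq_trans (esym (flieE logd (map_mx res X) (map_mx res p) i j)).
rewrite !resB res_act !res_sum [map_mx res p i j]mxE.
congr (_ - _ - _); apply: eq_bigr => k _;
  by rewrite resM [map_mx res X _ _]mxE [map_mx res p _ _]mxE logd_res.
Qed.

Lemma res_schouten p q k :
  map_mx res (schouten logd p q k) = schouten logd (map_mx res p) (map_mx res q) k.
Proof.
rewrite /schouten -[row k (map_mx res p)]map_row -[row k (map_mx res q)]map_row.
apply: eq_trans (map_mxD _ _ _) _; congr (_ + _); exact: res_flie.
Qed.

Lemma res_ham p f : map_mx res (ham logd p f) = ham logd (map_mx res p) (res f).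
Proof.
apply/rowP => i; rewrite !mxE res_sum; apply: eq_bigr => k _.
by rewrite resM mxE logd_res.
Qed.

(** * Rigidity of invariant tensors *)

Section Rigid.
Variable chi : 'rV[P]_n.
Hypothesis chia : forall i, chi ord0 (va i) = 'X_(vb (hi i)) - 'X_(vb (lo i)).
Hypothesis chib : forall k, aord 1 (chi ord0 (vb k)).

(** The only entries of the Jacobian of chi that are nonzero on a = 0 have a row of
  type a and a column of type b.  Hence the invariance equations of a tensor are
  triangular on a = 0 with respect to the number of its indices of type a. *)
Definition log_rank (k : 'I_n) : nat := (k < M)%N.

Lemma jac_gain d (i l : 'I_n) f : aord d f ->
  ((log_rank l < log_rank i)%N -> aord d.+1 f) -> aord d.+1 (logd l (chi ord0 i) * f).
Proof.
move=> hf hlow; have [/hlow|] := boolP (log_rank l < log_rank i)%N; first exact: aordMl.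
move=> ril; suff : aord 1 (logd l (chi ord0 i)) by move=> /aordM; apply.
move: ril; case: (split_ordP i) => j ->; last first.
  by move=> _; apply: aord_logd; apply: chib.
have -> : log_rank (lshift M.+1 j) = 1%N by rewrite /log_rank (ltn_ord j).
rewrite /log_rank; case: (ltnP l M) => // lM _; rewrite (chia j) raddfB /=.
have z (k : 'I_M.+1) : logd l 'X_(vb k) = 0.
  rewrite logdE mderivX mnm1E; case: eqP => [E|]; last by rewrite scale0r mulr0.
  by move: lM; rewrite -E /= ltnNge leq_addr.
by rewrite !z subrr; apply: aord0.
Qed.

Lemma rigid1 (V : 'rV[P]_n) : br logd chi V = 0 -> map_mx res V = 0 -> V = 0.
Proof.
move=> inv V0; apply/rowP => i; rewrite mxE.
apply: (@descent chi _ (fun i => V ord0 i) log_rank) => // {}i.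
  move=> j IH low; have := congr1 (fun A : 'rV[P]_n => A ord0 j) inv.
  rewrite !mxE => /eqP; rewrite subr_eq0 => /eqP ->.
  by apply: aord_sum => k _; rewrite mulrC; apply: jac_gain => // ?; apply: low.
by apply: aord1_res; have := congr1 (fun A : 'rV[P]_n => A ord0 i) V0; rewrite !mxE.
Qed.

Lemma rigid2 (p : 'M[P]_n) : flie logd chi p = 0 -> map_mx res p = 0 -> p = 0.
Proof.
move=> inv p0; apply/matrixP => i j; rewrite [RHS]mxE.
apply: (@descent chi _ (fun x => p x.1 x.2) (fun x => log_rank x.1 + log_rank x.2)%N _ _ _ _ (i, j)) => // [d|] {i j} [i j] /=.
  move=> IH low; have := congr1 (fun A : 'M[P]_n => A i j) inv.
  rewrite [RHS]mxE flieE => /eqP; rewrite -addrA -opprD subr_eq0 => /eqP ->.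
  apply: aordD; apply: aord_sum => k _; apply: jac_gain.
  - exact: (IH (k, j)).
  - by move=> ki; apply: (low (k, j)); rewrite ltn_add2r.
  - exact: (IH (i, k)).
  - by move=> ki; apply: (low (i, k)); rewrite ltn_add2l.
by apply: aord1_res; have := congr1 (fun A : 'M[P]_n => A i j) p0; rewrite !mxE.
Qed.

Lemma rigid3 (T : 'I_n -> 'M[P]_n) :
  (forall k, flie logd chi (T k) = \sum_l jac logd chi k l *: T l) ->
  (forall k, map_mx res (T k) = 0) -> forall k, T k = 0.
Proof.
move=> inv T0 k; apply/matrixP => i j; rewrite [RHS]mxE.
apply: (@descent chi _ (fun x => T x.1.1 x.1.2 x.2)
  (fun x => log_rank x.1.1 + log_rank x.1.2 + log_rank x.2)%N _ _ _ _ (k, i, j)) => // [d|] {k i j} [[k i] j] /=.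
  move=> IH low; have := congr1 (fun A : 'M[P]_n => A i j) (inv k).
  rewrite flieE summxE => /eqP.
  rewrite -addrA -opprD subr_eq => /eqP ->.
  apply: aordD; last apply: aordD; apply: aord_sum => l _.
  - rewrite !mxE; apply: jac_gain; first exact: (IH (l, i, j)).
    by move=> h; apply: (low (l, i, j)); rewrite !ltn_add2r.
  - apply: jac_gain; first exact: (IH (k, l, j)).
    by move=> h; apply: (low (k, l, j)); rewrite ltn_add2r ltn_add2l.
  - apply: jac_gain; first exact: (IH (k, i, l)).
    by move=> h; apply: (low (k, i, l)); rewrite ltn_add2l.
by apply: aord1_res; have := congr1 (fun A : 'M[P]_n => A i j) (T0 k); rewrite !mxE.
Qed.

End Rigid.

(** * Flaschka coordinates and the fields of the hierarchy *)

(** Indices of a and b are 1-based; a and b vanish outside their range, so that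
  the formulas below hold uniformly at the boundary of the lattice. *)
Definition a (i : nat) : P := fa R M.+1 i.
Definition b (i : nat) : P := fb R M.+1 i.

Arguments a : simpl never.
Arguments b : simpl never.

Lemma a0 : a 0 = 0. Proof. by []. Qed.
Lemma b0 : b 0 = 0. Proof. by []. Qed.
Lemma a_va (i : 'I_M) : a i.+1 = 'X_(va i).
Proof. by rewrite /a /fa valK. Qed.
Lemma b_vb (i : 'I_M.+1) : b i.+1 = 'X_(vb i).
Proof. by rewrite /b /fb valK. Qed.
Lemma a_out i : (M < i)%N -> a i = 0.
Proof. by case: i => // i iM; rewrite /a /fa insubF //= ltnNge -ltnS iM. Qed.
Lemma b_out i : (M.+1 < i)%N -> b i = 0.
Proof. by case: i => // i iM; rewrite /b /fb insubF //= ltnNge -ltnS iM. Qed.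

(** The field sum_i A_i a_i d/da_i + sum_i B_i d/db_i. *)
Definition log_vf (A B : nat -> P) : 'rV[P]_n :=
  \row_k match split k with inl i => A i.+1 | inr i => B i.+1 end.

Lemma log_vf_va A B i : log_vf A B ord0 (va i) = A i.+1.
Proof. by rewrite mxE -[va i]/(unsplit (inl i)) unsplitK. Qed.
Lemma log_vf_vb A B i : log_vf A B ord0 (vb i) = B i.+1.
Proof. by rewrite mxE -[vb i]/(unsplit (inr i)) unsplitK. Qed.

Lemma idxP (T : 'I_n -> Prop) : (forall i, T (va i)) -> (forall i, T (vb i)) -> forall k, T k.
Proof. by move=> ha hb k; case: (split_ordP k) => i ->; [exact: ha | exact: hb]. Qed.

Lemma log_vf_eq A B A' B' : (forall i, A i.+1 = A' i.+1) -> (forall i, B i.+1 = B' i.+1) ->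
  log_vf A B = log_vf A' B'.
Proof. by move=> hA hB; apply/rowP; elim/idxP => i; rewrite ?log_vf_va ?log_vf_vb. Qed.

Lemma br_log_vf A B A' B' : let X := log_vf A B in let Y := log_vf A' B' in
  br logd X Y = log_vf (fun i => act logd X (A' i) - act logd Y (A i))
                  (fun i => act logd X (B' i) - act logd Y (B i)).
Proof.
by move=> X Y; apply/rowP; elim/idxP => i; rewrite [LHS]mxE ?log_vf_va ?log_vf_vb /X /Y ?log_vf_va ?log_vf_vb.
Qed.

Lemma logdX k l : logd k 'X_l = (k == l)%:R * lscale l.
Proof.
rewrite logdE /lscale mderivX mnm1E eq_sym.
have -> : (U_(l) - U_(k) = if k == l then 0 else U_(l) - U_(k))%MM.
  by case: eqP => // ->; apply/mnmP => i; rewrite mnmBE subnn mnm0E.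
case: eqP => [->|_]; last by rewrite scale0r mulr0 mul0r.
by rewrite scale1r mpolyX0 mulr1 mul1r.
Qed.

Lemma act_X (V : 'rV[P]_n) k : act logd V 'X_k = V ord0 k * lscale k.
Proof.
rewrite /act (bigD1 k) //= logdX eqxx mul1r big1 ?addr0 // => l lk.
by rewrite logdX (negbTE lk) mul0r mulr0.
Qed.

Lemma act_a A B i : act logd (log_vf A B) (a i) = a i * A i.
Proof.
case: (ltnP M i) => iM; first by rewrite a_out // raddf0 mul0r.
case: i iM => [|i] iM; first by rewrite a0 raddf0 mul0r.
rewrite (a_va (Ordinal iM)) act_X log_vf_va mulrC; congr (_ * _).
by rewrite /lscale [(va _ < M)%N](iM : (va (Ordinal iM) < M)%N).
Qed.

(** Out of range b_i = 0, so that B_i is the derivative of b_i for every i only if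
  B vanishes there too. *)
Definition b_supported (B : nat -> P) := B 0%N = 0 /\ forall i, (M.+1 < i)%N -> B i = 0.

Lemma act_b A B i : b_supported B -> act logd (log_vf A B) (b i) = B i.
Proof.
case=> B0 Bout; case: (ltnP M.+1 i) => iM; first by rewrite b_out // raddf0 Bout.
case: i iM => [|i] iM; first by rewrite b0 raddf0 B0.
rewrite (b_vb (Ordinal iM)) act_X log_vf_vb /lscale.
by rewrite ifF ?mulr1 // ltnNge leq_addr.
Qed.

Lemma act1 V : act logd V 1 = 0.
Proof. by rewrite /act big1 // => k _; rewrite logdE -mpolyC1 mderivC !mulr0. Qed.
Lemma act_nat V k : act logd V k%:R = 0.
Proof. by rewrite raddfMn /= act1 mul0rn. Qed.
Lemma actD V f g : act logd V (f + g) = act logd V f + act logd V g.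
Proof. exact: raddfD. Qed.
Lemma actN V f : act logd V (- f) = - act logd V f.
Proof. exact: raddfN. Qed.
Lemma actMl V f g : act logd V (f * g) = act logd V f * g + f * act logd V g.
Proof. exact: (actM logdM). Qed.
Lemma actXn V f k : act logd V (f ^+ k.+1) = k.+1%:R * f ^+ k * act logd V f.
Proof.
elim: k => [|k IH]; first by rewrite expr1 expr0 !mul1r.
by rewrite exprS actMl IH [f ^+ k.+1 in RHS]exprS [f ^+ k.+1 in LHS]exprS; ring.
Qed.
Definition actE := (actD, actN, actMl, actXn, act_nat, act1).

Definition chiA (i : nat) : P := b i.+1 - b i.
Definition chiB (i : nat) : P := 2%:R * (a i ^+ 2 - a i.-1 ^+ 2).
Definition chi := log_vf chiA chiB.

Definition sig (i : nat) : P := \sum_(1 <= k < i) b k.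

Arguments sig : simpl never.

(** The logarithmic components of X1 and X2. *)
Definition xi1A (i : nat) : P := - i%:R * b i + (i%:R + 2%:R) * b i.+1.
Definition xi1B (i : nat) : P := (2%:R * i%:R + 3%:R) * a i ^+ 2
              + (1 - 2%:R * i%:R) * a i.-1 ^+ 2 + b i ^+ 2.
Definition xi1 := log_vf xi1A xi1B.

Definition xi2A (i : nat) : P := (2%:R - i%:R) * a i.-1 ^+ 2
              + (1 - i%:R) * b i ^+ 2
              + b i * b i.+1
              + (i%:R + 1) * a i.+1 ^+ 2
              + (i%:R + 1) * b i.+1 ^+ 2
              + a i ^+ 2
              + sig i * (b i.+1 - b i).
Definition xi2B (i : nat) : P := 2%:R * sig i * a i ^+ 2
              - 2%:R * sig i.-1 * a i.-1 ^+ 2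
              + (2%:R * i%:R + 2%:R) * a i ^+ 2 * b i
              + (2%:R * i%:R + 1) * a i ^+ 2 * b i.+1
              + (3%:R - 2%:R * i%:R) * a i.-1 ^+ 2 * b i.-1
              + (4%:R - 2%:R * i%:R) * a i.-1 ^+ 2 * b i
              + b i ^+ 3.
Definition xi2 := log_vf xi2A xi2B.

(** The Hamiltonian fields of H_3 and H_4 for the first bracket. *)
Definition chi4A (i : nat) : P := b i.+1 ^+ 2 - b i ^+ 2 + a i.+1 ^+ 2 - a i.-1 ^+ 2.
Definition chi4B (i : nat) : P :=
  2%:R * (a i ^+ 2 * (b i + b i.+1) - a i.-1 ^+ 2 * (b i.-1 + b i)).
Definition chi4 := log_vf chi4A chi4B.

(** cube i and cubeo i are the entry (i, i) of L^3 and a_i times its entry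
  (i, i+1), for L the Jacobi matrix. *)
Definition cube (i : nat) : P := b i ^+ 3 + a i ^+ 2 * (2%:R * b i + b i.+1)
  + a i.-1 ^+ 2 * (2%:R * b i + b i.-1).
Definition cubeo (i : nat) : P := a i ^+ 2 * (b i ^+ 2 + b i * b i.+1 + b i.+1 ^+ 2
  + a i.-1 ^+ 2 + a i ^+ 2 + a i.+1 ^+ 2).
Definition chi5A (i : nat) : P := cube i.+1 - cube i.
Definition chi5B (i : nat) : P := 2%:R * (cubeo i - cubeo i.-1).
Definition chi5 := log_vf chi5A chi5B.

Lemma sigS i : sig i.+1 = sig i + b i.
Proof.
case: i => [|i]; first by rewrite /sig !big_geq // b0 addr0.
by rewrite /sig big_nat_recr.
Qed.

Lemma b_supportedP B : (forall i, a i = 0 -> a i.-1 = 0 -> b i = 0 -> B i = 0) -> b_supported B.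
Proof.
move=> h; split=> [|i iM]; apply: h => //; by [apply: a_out; lia | apply: b_out].
Qed.

Lemma chiB_supported : b_supported chiB.
Proof. by apply: b_supportedP => i h h' hb; rewrite /chiB h h'; ring. Qed.
Lemma xi1B_supported : b_supported xi1B.
Proof. by apply: b_supportedP => i h h' hb; rewrite /xi1B h h' hb; ring. Qed.
Lemma xi2B_supported : b_supported xi2B.
Proof. by apply: b_supportedP => i h h' hb; rewrite /xi2B h h' hb; ring. Qed.
Lemma chi4B_supported : b_supported chi4B.
Proof. by apply: b_supportedP => i h h' hb; rewrite /chi4B h h'; ring. Qed.
Lemma chi5B_supported : b_supported chi5B.
Proof. by apply: b_supportedP => i h h' hb; rewrite /chi5B /cubeo h h'; ring. Qed.

Lemma act_chi_sig i : act logd chi (sig i) = 2%:R * a i.-1 ^+ 2.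
Proof.
elim: i => [|i IH]; first by rewrite /sig big_geq // raddf0 a0; ring.
by rewrite sigS raddfD /= IH (act_b _ _ chiB_supported) /chiB; ring.
Qed.

Lemma act_chi_b A i : act logd (log_vf A chiB) (b i) = chiB i. Proof. exact: act_b chiB_supported. Qed.
Lemma act_xi1_b A i : act logd (log_vf A xi1B) (b i) = xi1B i. Proof. exact: act_b xi1B_supported. Qed.
Lemma act_xi2_b A i : act logd (log_vf A xi2B) (b i) = xi2B i. Proof. exact: act_b xi2B_supported. Qed.
Lemma act_chi4_b A i : act logd (log_vf A chi4B) (b i) = chi4B i. Proof. exact: act_b chi4B_supported. Qed.
Lemma act_chi5_b A i : act logd (log_vf A chi5B) (b i) = chi5B i. Proof. exact: act_b chi5B_supported. Qed.
Definition actvarE :=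
  (act_a, act_chi_b, act_xi1_b, act_xi2_b, act_chi4_b, act_chi5_b, act_chi_sig).

Lemma br_xi1_chi : br logd xi1 chi = chi4.
Proof.
rewrite br_log_vf; apply: log_vf_eq => i; rewrite /chiA /chiB /xi1A /xi1B /chi4A /chi4B.
  rewrite !actE !actvarE /chiA /chiB /xi1A /xi1B /=; ring.
rewrite !actE !actvarE /chiA /chiB /xi1A /xi1B /=; ring.
Qed.

Lemma br_chi_chi4 : br logd chi chi4 = 0.
Proof.
have -> : 0 = log_vf (fun _ => 0) (fun _ => 0).
  by apply/rowP; elim/idxP => i; rewrite ?log_vf_va ?log_vf_vb mxE.
rewrite br_log_vf; apply: log_vf_eq => i; rewrite /chiA /chiB /chi4A /chi4B.
  rewrite !actE !actvarE /chiA /chiB /chi4A /chi4B /=; ring.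
rewrite !actE !actvarE /chiA /chiB /chi4A /chi4B /=; ring.
Qed.

Lemma br_xi2_chi : br logd xi2 chi = chi5.
Proof.
rewrite br_log_vf; apply: log_vf_eq => i;
  rewrite /chiA /chiB /xi2A /xi2B /chi5A /chi5B /cube /cubeo.
  rewrite !actE !actvarE /chiA /chiB /xi2A /xi2B /= !sigS; ring.
rewrite !actE !actvarE /chiA /chiB /xi2A /xi2B /= !sigS; ring.
Qed.

Lemma br_chi_chi5 : br logd chi chi5 = 0.
Proof.
have -> : 0 = log_vf (fun _ => 0) (fun _ => 0).
  by apply/rowP; elim/idxP => i; rewrite ?log_vf_va ?log_vf_vb mxE.
rewrite br_log_vf; apply: log_vf_eq => i; rewrite /chiA /chiB /chi5A /chi5B /cube /cubeo.
  rewrite !actE !actvarE /chiA /chiB /chi5A /chi5B /cube /cubeo /=; ring.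
rewrite !actE !actvarE /chiA /chiB /chi5A /chi5B /cube /cubeo /=.
(* The successor of i.-1 is i only for i > 0; for i = 0 the terms vanish with a_0. *)
by case: i => [|i] /=; rewrite ?a0; ring.
Qed.

(** * Skew matrices in block form *)

Definition skew_mx (aa ab bb : nat -> nat -> P) : 'M[P]_n :=
  \matrix_(k, l) match split k, split l with
    | inl i, inl j => aa i.+1 j.+1
    | inl i, inr j => ab i.+1 j.+1
    | inr i, inl j => - ab j.+1 i.+1
    | inr i, inr j => bb i.+1 j.+1
    end.

Lemma split_va i : split (va i) = inl i.
Proof. by rewrite -[va i]/(unsplit (inl i)) unsplitK. Qed.
Lemma split_vb i : split (vb i) = inr i.
Proof. by rewrite -[vb i]/(unsplit (inr i)) unsplitK. Qed.

Lemma skew_mx_aa aa ab bb i j : skew_mx aa ab bb (va i) (va j) = aa i.+1 j.+1.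
Proof. by rewrite mxE !split_va. Qed.
Lemma skew_mx_ab aa ab bb i j : skew_mx aa ab bb (va i) (vb j) = ab i.+1 j.+1.
Proof. by rewrite mxE split_va split_vb. Qed.
Lemma skew_mx_ba aa ab bb i j : skew_mx aa ab bb (vb i) (va j) = - ab j.+1 i.+1.
Proof. by rewrite mxE split_va split_vb. Qed.
Lemma skew_mx_bb aa ab bb i j : skew_mx aa ab bb (vb i) (vb j) = bb i.+1 j.+1.
Proof. by rewrite mxE !split_vb. Qed.
Definition skew_mxE := (skew_mx_aa, skew_mx_ab, skew_mx_ba, skew_mx_bb).

Lemma idx2P (T : 'I_n -> 'I_n -> Prop) :
  (forall i j, T (va i) (va j)) -> (forall i j, T (va i) (vb j)) ->
  (forall i j, T (vb i) (va j)) -> (forall i j, T (vb i) (vb j)) -> forall k l, T k l.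
Proof. by move=> h1 h2 h3 h4; elim/idxP => i; elim/idxP => j. Qed.

Lemma skew_mx_skew aa ab bb : (forall i j, aa j i = - aa i j) ->
  (forall i j, bb j i = - bb i j) -> (skew_mx aa ab bb)^T = - skew_mx aa ab bb.
Proof.
move=> ha hb; apply/matrixP => k l; rewrite mxE [RHS]mxE; elim/idx2P: k / l => i j;
by rewrite !skew_mxE ?opprK.
Qed.

Lemma row_skew_mx_a aa ab bb i :
  row (va i) (skew_mx aa ab bb) = log_vf (aa i.+1) (ab i.+1).
Proof.
by apply/rowP; elim/idxP => j; rewrite [LHS]mxE ?log_vf_va ?log_vf_vb !skew_mxE.
Qed.
Lemma row_skew_mx_b aa ab bb i :
  row (vb i) (skew_mx aa ab bb) = log_vf (fun j => - ab j i.+1) (bb i.+1).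
Proof.
by apply/rowP; elim/idxP => j; rewrite [LHS]mxE ?log_vf_va ?log_vf_vb !skew_mxE.
Qed.

(** * Derivations of the ring of functions of b *)

(** The derivation d/db_l, with l any natural number, zero out of range. *)
Definition db_fun (l : nat) (f : P) : P := \sum_(k < M.+1) (k.+1 == l)%:R * logd (vb k) f.
Lemma db_is_additive l : zmod_morphism (db_fun l).
Proof.
by move=> f g; rewrite /db_fun -sumrB; apply: eq_bigr => k _; rewrite raddfB mulrBr.
Qed.
HB.instance Definition _ l := GRing.isZmodMorphism.Build P P (db_fun l) (db_is_additive l).
Definition db (l : nat) : {additive P -> P} := db_fun l.
Arguments db : simpl never.

Lemma dbE l f : db l f = \sum_(k < M.+1) (k.+1 == l)%:R * logd (vb k) f.
Proof. by []. Qed.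

Lemma db_vb k f : db k.+1 f = if insub k is Some k' then logd (vb k') f else 0.
Proof.
rewrite /db /= /db_fun; case: insubP => [k' _ <-|/negP kM].
  rewrite (bigD1 k') //= eqxx mul1r big1 ?addr0 // => i ik.
  by rewrite eqSS (negbTE (ik : val i != val k')) mul0r.
rewrite big1 // => i _; rewrite eqSS; case: eqP => [ik|_]; last by rewrite mul0r.
by case: kM; rewrite -ik ltn_ord.
Qed.

Lemma db0 f : db 0 f = 0.
Proof. by rewrite /db /= /db_fun big1 // => i _; rewrite mul0r. Qed.

Lemma dbM l f g : db l (f * g) = db l f * g + f * db l g.
Proof.
case: l => [|l]; first by rewrite !db0 mul0r mulr0 addr0.
by rewrite !db_vb; case: insub => [k|]; rewrite ?logdM // mul0r mulr0 addr0.
Qed.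

Lemma dbC l m f : db l (db m f) = db m (db l f).
Proof.
case: l m => [|l] [|m]; rewrite ?db0 ?raddf0 //.
by rewrite !db_vb; case: insub => [k|]; case: insub => [k'|]; rewrite ?raddf0 // logdC.
Qed.

Lemma db_b_neq l i : l != i -> db l (b i) = 0.
Proof.
case: l => [|l] li; first by rewrite db0.
rewrite db_vb; case: insubP => // k _ kl.
case: i li => [|i] li; first by rewrite b0 raddf0.
case: (ltnP i M.+1) => iM; last by rewrite b_out // raddf0.
rewrite (b_vb (Ordinal iM)) logdX; case: eqP => [/rshift_inj E|]; last by rewrite mul0r.
by move: li; rewrite eqSS -kl E eqxx.
Qed.

Lemma db_b (i : 'I_M.+1) : db i.+1 (b i.+1) = 1.
Proof. by rewrite db_vb valK b_vb logdX eqxx mul1r /lscale ltnNge leq_addr. Qed.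

Lemma db1 l : db l 1 = 0.
Proof.
by have := dbM l 1 1; rewrite !mulr1 mul1r -{1}[db l 1]addr0 => /addrI.
Qed.

Definition afree (f : P) := res f = f.

Lemma afree0 : afree 0. Proof. exact: raddf0. Qed.
Lemma afreeD f g : afree f -> afree g -> afree (f + g).
Proof. by move=> hf hg; rewrite /afree resD hf hg. Qed.
Lemma afreeN f : afree f -> afree (- f).
Proof. by move=> hf; rewrite /afree resN hf. Qed.
Lemma afreeM f g : afree f -> afree g -> afree (f * g).
Proof. by move=> hf hg; rewrite /afree resM hf hg. Qed.
Lemma afreeXn f k : afree f -> afree (f ^+ k).
Proof. by move=> hf; rewrite /afree rmorphXn /= hf. Qed.
Lemma afreeMn (k : nat) : afree k%:R.
Proof. exact: rmorph_nat. Qed.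
Lemma afreeC c : afree c%:MP.
Proof. by rewrite /afree /res mmapC. Qed.
Lemma afree_sum (I : Type) (r : seq I) (Q : pred I) (F : I -> P) :
  (forall i, Q i -> afree (F i)) -> afree (\sum_(i <- r | Q i) F i).
Proof. by move=> h; rewrite /afree res_sum; apply: eq_bigr => i /h. Qed.

Lemma res_a i : res (a i) = 0.
Proof.
case: (ltnP M i) => iM; first by rewrite a_out // raddf0.
case: i iM => [|i] iM; first by rewrite a0 raddf0.
by rewrite (a_va (Ordinal iM)) /res mmapX mmap1U ifT.
Qed.
Lemma afree_b i : afree (b i).
Proof.
case: (ltnP M.+1 i) => iM; first by rewrite b_out //; apply: afree0.
case: i iM => [|i] iM; first by rewrite b0; apply: afree0.
by rewrite (b_vb (Ordinal iM)) /afree /res mmapX mmap1U ifF // ltnNge leq_addr.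
Qed.
Lemma afree_db l f : afree f -> afree (db l f).
Proof.
move=> hf; rewrite dbE; apply: afree_sum => k _; apply: afreeM; first exact: afreeMn.
by rewrite /afree -logd_res hf.
Qed.

Lemma act_afree A B f : afree f -> act logd (log_vf A B) f = \sum_(k < M.+1) B k.+1 * db k.+1 f.
Proof.
move=> hf; rewrite /act big_split_ord /= big1 ?add0r => [|i _]; last first.
  by rewrite -{1}hf [logd _ _]logd_res_a mulr0.
by apply: eq_bigr => k _; rewrite log_vf_vb db_vb valK.
Qed.

Lemma act_afree0 A f : afree f -> act logd (log_vf A (fun=> 0)) f = 0.
Proof. by move=> hf; rewrite act_afree // big1 // => k _; rewrite mul0r. Qed.

Lemma afree_act A B f : (forall i, afree (B i)) -> afree f -> afree (act logd (log_vf A B) f).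
Proof.
by move=> hB hf; rewrite act_afree //; apply: afree_sum => k _; apply: afreeM => //; apply: afree_db.
Qed.

Lemma neq_succ (i : nat) : ((i == i.+1) = false) * ((i.+1 == i) = false)
  * ((i == i.+2) = false) * ((i.+2 == i) = false).
Proof. by do !split; lia. Qed.

(** The bracket {log a_i, b_j} of the first Toda tensor. *)
Definition eps (i j : nat) : P := (j == i.+1)%:R - (j == i)%:R.

Lemma act_eps A (x : nat -> P) i f : afree f ->
  act logd (log_vf A (fun j => eps i j * x j)) f = x i.+1 * db i.+1 f - x i * db i f.
Proof.
move=> hf; rewrite act_afree //.
have E l : x l * db l f = \sum_(k < M.+1) (k.+1 == l)%:R * (x k.+1 * db k.+1 f).
  rewrite dbE big_distrr /=; apply: eq_bigr => k _.
  by case: eqP => [<-|_]; rewrite ?mul0r ?mulr0 // !mul1r db_vb valK.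
rewrite !E -sumrB; apply: eq_bigr => k _; rewrite /eps; ring.
Qed.

Lemma res_log_vf A B : map_mx res (log_vf A B) = log_vf (fun i => res (A i)) (fun i => res (B i)).
Proof.
by apply/rowP; elim/idxP => i; rewrite mxE ?log_vf_va ?log_vf_vb.
Qed.

Lemma db_nat l k : db l k%:R = 0.
Proof. by rewrite raddfMn /= db1 mul0rn. Qed.
Lemma dbXn l f k : db l (f ^+ k.+1) = k.+1%:R * f ^+ k * db l f.
Proof.
elim: k => [|k IH]; first by rewrite expr1 expr0 !mul1r.
by rewrite exprS dbM IH [f ^+ k.+1 in RHS]exprS [f ^+ k.+1 in LHS]exprS; ring.
Qed.

(** * Normal form of the brackets on a = 0 *)

Definition diff2 (G : nat -> nat -> P) (i j : nat) : P :=
  G i.+1 j.+1 - G i.+1 j - G i j.+1 + G i j.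

(** G(i, k) plays the role of the bracket of log (a_1 ... a_{i-1}) and
  log (a_1 ... a_{k-1}) on a = 0; its mixed second difference is then the bracket
  of log a_i and log a_k. *)
Record local_kernel (G : nat -> nat -> P) : Prop := LocalKernel {
  kernel_skew : forall i j, G j i = - G i j;
  kernel_afree : forall i j, afree (G i j);
  kernel_local : forall i j l, l != i -> l != j -> db l (G i j) = 0
}.

Lemma kernel_diag G i : local_kernel G -> G i i = 0.
Proof.
move=> gG; have /eqP := kernel_skew gG i i; rewrite -addr_eq0 -mulr2n.
by rewrite -(scaler_nat _ (G i i : P)) scaler_eq0 pnatr_eq0 /= => /eqP.
Qed.

Definition nf (G : nat -> nat -> P) (x : nat -> P) : 'M[P]_n :=
  skew_mx (diff2 G) (fun i j => eps i j * x j) (fun _ _ => 0).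

Lemma diff2_afree G i j : local_kernel G -> afree (diff2 G i j).
Proof.
by move=> gG; rewrite /diff2; do ![apply: afreeD | apply: afreeN]; apply: kernel_afree.
Qed.

Lemma nf_skew G x : local_kernel G -> (nf G x)^T = - nf G x.
Proof.
move=> gG; apply: skew_mx_skew => i j; last by rewrite oppr0.
rewrite /diff2; rewrite (kernel_skew gG j.+1 i.+1) (kernel_skew gG j.+1 i) (kernel_skew gG j i.+1).
rewrite (kernel_skew gG j i); ring.
Qed.

Lemma row_nf_a G x i : row (va i) (nf G x) = log_vf (diff2 G i.+1) (fun j => eps i.+1 j * x j).
Proof. exact: row_skew_mx_a. Qed.
Lemma row_nf_b G x i : row (vb i) (nf G x)
  = log_vf (fun j => - (eps j i.+1 * x i.+1)) (fun=> 0).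
Proof. exact: row_skew_mx_b. Qed.

Lemma eps_afree i j : afree (eps i j).
Proof. by apply: afreeD; [|apply: afreeN]; apply: afreeMn. Qed.

(** Differences in the indices commute with all operations, so G and x change as
  brackets of the coordinates log (a_1 ... a_{i-1}) and b_k would; Xi_i and phi_k
  are the components of the field in these coordinates. *)
Lemma flie_nf G x Xi phi : local_kernel G -> (forall i, afree (x i)) ->
  (forall i, afree (Xi i)) -> (forall i, afree (phi i)) ->
  (forall i l, l != i -> db l (phi i) = 0) ->
  let X := log_vf (fun i => Xi i.+1 - Xi i) phi in
  flie logd X (nf G x) =
    skew_mx (diff2 (fun i j => act logd X (G i j) + x j * db j (Xi i) - x i * db i (Xi j)))
      (fun i j => eps i j * (act logd X (x j) - x j * db j (phi j))) (fun _ _ => 0).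
Proof.
move=> gG bx bXi bphi lphi X; apply/matrixP => k l.
have bX i : afree (Xi i.+1 - Xi i) by apply: afreeD; [|apply: afreeN].
have ab i j : act logd X (eps i j * x j)
    - (x i.+1 * db i.+1 (phi j) - x i * db i (phi j))
    = eps i j * (act logd X (x j) - x j * db j (phi j)).
  have E m : db m (phi j) = (m == j)%:R * db m (phi m).
    by case: eqP => [<-|/eqP mj]; rewrite ?mul1r // mul0r lphi.
  rewrite (E i.+1) (E i) actMl [act logd X (eps _ _)](_ : _ = 0); last first.
    by rewrite /eps raddfB /= !act_nat subrr.
  rewrite /eps ![(_ == j)]eq_sym.
  have [->|_] := eqVneq j i.+1.
    by rewrite !neq_succ /=; ring.
  by have [->|_] := eqVneq j i => /=; ring.
rewrite flie_skewE; last exact: nf_skew.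
elim/idx2P: k / l => i j; rewrite ?row_nf_a ?row_nf_b !skew_mxE ?log_vf_va ?log_vf_vb ?act_eps ?act_afree0 //.
- rewrite /diff2 !(raddfD, raddfN) /=; ring.
- by rewrite addr0 ab.
- by rewrite subr0 raddfN /= -ab opprB addrC.
- by rewrite raddf0 addr0 subr0.
Qed.

(** For distinct i, j, k every term vanishes by locality; if two indices agree,
  one term vanishes and the other two are opposite, by skewness. *)
Lemma kernel_cyclic G G' x x' i j k : local_kernel G -> local_kernel G' ->
  let u k i j := x k * db k (G' i j) + x' k * db k (G i j) in
  u k i j + u j k i + u i j k = 0.
Proof.
move=> gG gG' u; pose sk := (kernel_skew gG, kernel_skew gG').
have u0 m r s : m != r -> m != s -> u m r s = 0.
  by move=> mr ms; rewrite /u (kernel_local gG) // (kernel_local gG') // !mulr0 addr0.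
have uS m r s : u m s r = - u m r s.
  by rewrite /u (kernel_skew gG r s) (kernel_skew gG' r s) !raddfN /=; ring.
have ud m r : u m r r = 0.
  by rewrite /u !kernel_diag // !raddf0 !mulr0 addr0.
have [<-|ki] := eqVneq k i; first by rewrite ud addr0 uS addNr.
have [<-|kj] := eqVneq k j; first by rewrite ud addr0 uS addNr.
have [<-|ij] := eqVneq i j; first by rewrite ud uS add0r addNr.
by rewrite !u0 ?addr0 // eq_sym.
Qed.

Lemma db_diff2 m G i j : db m (diff2 G i j) = diff2 (fun r s => db m (G r s)) i j.
Proof. by rewrite /diff2 raddfD !raddfB. Qed.

(** The Jacobi expression of second differences is the third difference of the
  Jacobi expression of the kernels. *)
Lemma third_difference (x x' : nat -> P) (q q' : nat -> nat -> nat -> P) k i j :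
  (forall m r s, x m * q' m r s + x' m * q m r s + (x s * q' s m r + x' s * q s m r)
    - (x r * q' r m s + x' r * q r m s) = 0) ->
  x k.+1 * diff2 (q' k.+1) i j - x k * diff2 (q' k) i j
  + (x' j.+1 * diff2 (q j.+1) k i - x' j * diff2 (q j) k i)
  - (x' i.+1 * diff2 (q i.+1) k j - x' i * diff2 (q i) k j)
  + (x' k.+1 * diff2 (q k.+1) i j - x' k * diff2 (q k) i j
  + (x j.+1 * diff2 (q' j.+1) k i - x j * diff2 (q' j) k i)
  - (x i.+1 * diff2 (q' i.+1) k j - x i * diff2 (q' i) k j)) = 0.
Proof.
move=> h; pose t m r s := x m * q' m r s + x' m * q m r s
  + (x s * q' s m r + x' s * q s m r) - (x r * q' r m s + x' r * q r m s).
transitivity (t k.+1 i.+1 j.+1 - t k i.+1 j.+1 - t k.+1 i j.+1 - t k.+1 i.+1 j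
  + t k i j.+1 + t k i.+1 j + t k.+1 i j - t k i j); last by rewrite /t !h; ring.
by rewrite /t /diff2; ring.
Qed.

Lemma schouten_nf G G' x x' k : local_kernel G -> local_kernel G' ->
  (forall i, afree (x i)) -> (forall i, afree (x' i)) ->
  (forall i l, l != i -> db l (x i) = 0) -> (forall i l, l != i -> db l (x' i) = 0) ->
  schouten logd (nf G x) (nf G' x') k = 0.
Proof.
move=> gG gG' bx bx' lx lx'; apply/matrixP => i j; rewrite [RHS]mxE schoutenE.
have E1 := flie_skewE logd (row k (nf G x)) i j (nf_skew x' gG').
have E2 := flie_skewE logd (row k (nf G' x')) i j (nf_skew x gG).
apply: eq_trans (congr2 +%R E1 E2) _ => {E1 E2}.
have beps y r s : (forall i, afree (y i)) -> afree (eps r s * y s).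
  by move=> hy; apply: afreeM => //; apply: eps_afree.
have bdd := diff2_afree; have b0 := afree0.
have bN := afreeN.
have E w y r s m : (forall i l, l != i -> db l (y i) = 0) ->
    w m.+1 * db m.+1 (eps r s * y s) - w m * db m (eps r s * y s)
    = eps r s * (eps m s * (w s * db s (y s))) :> P.
  move=> ly; rewrite !dbM [db _ (eps r s)](_ : _ = 0); last first.
    by rewrite /eps raddfB /= !db_nat subrr.
  rewrite [db _ (eps r s)](_ : _ = 0); last by rewrite /eps raddfB /= !db_nat subrr.
  rewrite [eps m s]/eps; have [->|sm1] := eqVneq s m.+1; first by rewrite neq_succ /= (ly m.+1 m) ?neq_succ //; ring.
  rewrite (ly s m.+1) 1?eq_sym //; have [->|sm] := eqVneq s m; first by rewrite /=; ring.
  by rewrite (ly s m) 1?eq_sym //=; ring.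
have EN w y r s m : (forall i l, l != i -> db l (y i) = 0) ->
    w m.+1 * db m.+1 (- (eps r s * y s)) - w m * db m (- (eps r s * y s))
    = - (eps r s * (eps m s * (w s * db s (y s)))) :> P.
  by move=> ly; rewrite !raddfN /= -E //; ring.
pose t m r s := x m * db m (G' r s) + x' m * db m (G r s)
  + (x s * db s (G' m r) + x' s * db s (G m r))
  - (x r * db r (G' m s) + x' r * db r (G m s)).
have t0 m r s : t m r s = 0.
  rewrite -[RHS](kernel_cyclic x x' r s m gG gG') /t (kernel_skew gG s m) (kernel_skew gG' s m).
  by rewrite !raddfN /=; ring.
elim/idxP: k => k; elim/idx2P: i / j => i j;
  rewrite ?row_nf_a ?row_nf_b ?[row _ _ _ _]mxE !skew_mxE ?log_vf_va ?log_vf_vb;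
  rewrite ?act_eps ?act_afree0 //; try by [apply: bdd | apply: b0 | apply: beps | apply/bN/beps].
- rewrite !(db_diff2 _ G) !(db_diff2 _ G').
  exact: (@third_difference x x' (fun m r s => db m (G r s))
            (fun m r s => db m (G' r s)) k.+1 i.+1 j.+1 t0).
- by rewrite !E //; ring.
- rewrite (EN x x') // (EN x' x) // (E x' x) // (E x x') //; ring.
- by rewrite !raddf0; ring.
- rewrite (EN x' x i.+1 k.+1 j.+1) // (EN x' x j.+1 k.+1 i.+1) //.
  rewrite (EN x x' i.+1 k.+1 j.+1) // (EN x x' j.+1 k.+1 i.+1) //; ring.
- by rewrite !raddf0; ring.
- by rewrite !raddf0; ring.
- by ring.
Qed.

Lemma skew_mx_eq aa ab bb aa' ab' bb' :
  (forall i j : 'I_M, aa i.+1 j.+1 = aa' i.+1 j.+1) ->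
  (forall (i : 'I_M) (j : 'I_M.+1), ab i.+1 j.+1 = ab' i.+1 j.+1) ->
  (forall i j : 'I_M.+1, bb i.+1 j.+1 = bb' i.+1 j.+1) ->
  skew_mx aa ab bb = skew_mx aa' ab' bb'.
Proof.
by move=> ha hab hb; apply/matrixP => k l; elim/idx2P: k / l => i j; rewrite !skew_mxE ?ha ?hab ?hb.
Qed.

Lemma skew_mx0 : skew_mx (fun _ _ => 0) (fun _ _ => 0) (fun _ _ => 0) = 0.
Proof.
by apply/matrixP => k l; rewrite [RHS]mxE; elim/idx2P: k / l => i j; rewrite skew_mxE ?oppr0.
Qed.

Lemma map_skew_mx f aa ab bb : (forall x, f (- x) = - f x) ->
  map_mx f (skew_mx aa ab bb) = skew_mx (fun i j => f (aa i j)) (fun i j => f (ab i j)) (fun i j => f (bb i j)).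
Proof.
by move=> fN; apply/matrixP => k l; rewrite mxE; elim/idx2P: k / l => i j; rewrite !skew_mxE ?fN.
Qed.

Lemma act_eps0 V i j : act logd V (eps i j) = 0.
Proof. by rewrite /eps raddfB /= !act_nat subrr. Qed.

Lemma eps_supported (i : 'I_M) : b_supported (eps i.+1).
Proof.
split=> [|j Mj]; rewrite /eps ?subrr //.
have iM := ltn_ord i.
have -> : (j == i.+2) = false by lia.
have -> : (j == i.+1) = false by lia.
by rewrite subrr.
Qed.

Lemma zero_supported : b_supported (fun=> 0 : P). Proof. by []. Qed.

(** * The first two brackets *)

Definition half : P := (2%:R^-1)%:MP.
Lemma halfD x : half * x + half * x = x.
Proof.
rewrite -mulrDl -mpolyCD -[X in (X + _)%:MP]mul1r -[X in (_ + X)%:MP]mul1r -splitr mpolyC1.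
by rewrite mul1r.
Qed.

Definition log_toda1 : 'M[P]_n := skew_mx (fun _ _ => 0) eps (fun _ _ => 0).
Definition log_toda2 : 'M[P]_n :=
  skew_mx (fun i j => half * ((j == i.+1)%:R - (i == j.+1)%:R))
      (fun i j => (j == i.+1)%:R * b i.+1 - (j == i)%:R * b i)
      (fun i j => 2%:R * ((j == i.+1)%:R * a i ^+ 2 - (i == j.+1)%:R * a j ^+ 2)).

Lemma log_toda1_skew : log_toda1^T = - log_toda1.
Proof. by apply: skew_mx_skew => i j; rewrite oppr0. Qed.

Lemma row_toda1_a i : row (va i) log_toda1 = log_vf (fun=> 0) (eps i.+1).
Proof. exact: row_skew_mx_a. Qed.
Lemma row_toda1_b i : row (vb i) log_toda1 = log_vf (fun j => - eps j i.+1) (fun=> 0).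
Proof. exact: row_skew_mx_b. Qed.

(** The entries of p = log_toda1 are constant, so L_chi p = (J p)^T - J p, and J p
  is symmetric. *)
Lemma flie_chi_toda1 : flie logd chi log_toda1 = 0.
Proof.
apply/matrixP => k l; rewrite [RHS]mxE flie_skewE; last exact: log_toda1_skew.
elim/idx2P: k / l => i j; rewrite ?row_toda1_a ?row_toda1_b !skew_mxE ?log_vf_va ?log_vf_vb /chiA /chiB ?act_eps0 ?actE ?act_a.
- rewrite !(act_b _ _ (eps_supported _)) raddf0; move: (i : nat) (j : nat) => {}i {}j.
  rewrite /eps !eqSS !(eq_sym j) !(eq_sym j.+1); ring.
- by rewrite !(act_b _ _ zero_supported); ring.
- by rewrite !(act_b _ _ zero_supported); ring.
- rewrite raddf0; move: (i : nat) (j : nat) => {}i {}j /=.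
  rewrite /eps !eqSS.
  have [->|ji] := eqVneq j i.+1; first by rewrite !neq_succ /=; ring.
  have [->|ij] := eqVneq i j.+1; first by rewrite !neq_succ /=; ring.
  by have [->|_] := eqVneq j i; rewrite /=; ring.
Qed.

Lemma flie_xi1_toda1 : flie logd xi1 log_toda1 = - (log_toda2 + log_toda2).
Proof.
apply/matrixP => k l; rewrite [RHS]mxE [in RHS]mxE flie_skewE; last exact: log_toda1_skew.
elim/idx2P: k / l => i j; rewrite ?row_toda1_a ?row_toda1_b !skew_mxE ?log_vf_va ?log_vf_vb /xi1A /xi1B ?act_eps0 ?actE ?act_a.
- rewrite !(act_b _ _ (eps_supported _)) raddf0 halfD; move: (i : nat) (j : nat) => {}i {}j.
  rewrite /eps !eqSS.
  have [->|ji] := eqVneq j i.+1; first by rewrite !neq_succ /=; ring.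
  have [->|ij] := eqVneq i j.+1; first by rewrite !neq_succ /=; ring.
  by have [->|_] := eqVneq j i; rewrite /=; ring.
- rewrite !(act_b _ _ zero_supported) !(act_b _ _ (eps_supported _)).
  move: (i : nat) (j : nat) => {}i {}j; rewrite /eps !eqSS.
  have [->|ji] := eqVneq j i.+1; first by rewrite !neq_succ /=; ring.
  by have [->|_] := eqVneq j i; rewrite /=; ring.
- rewrite !(act_b _ _ zero_supported) !(act_b _ _ (eps_supported _)).
  move: (i : nat) (j : nat) => {}i {}j; rewrite /eps !eqSS.
  have [->|ji] := eqVneq i j.+1; first by rewrite !neq_succ /=; ring.
  by have [->|_] := eqVneq j i; rewrite /=; ring.
- rewrite !(act_b _ _ zero_supported) raddf0; move: (i : nat) (j : nat) => {}i {}j /=.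
  rewrite /eps !eqSS.
  have [->|ji] := eqVneq j i.+1; first by rewrite !neq_succ /=; ring.
  have [->|ij] := eqVneq i j.+1; first by rewrite !neq_succ /=; ring.
  by have [->|_] := eqVneq j i; rewrite /=; ring.
Qed.

(** * The master symmetries on a = 0 *)

(** On a = 0 the logarithmic a-components of X1 and X2 are differences of a
  potential Xi_i.  It depends on all of b_1, ..., b_i, but its second derivatives
  in two distinct variables other than b_i vanish; this keeps the kernels
  local. *)
Record local_potential (Xi : nat -> P) : Prop := LocalPotential {
  potential_afree : forall i, afree (Xi i);
  potential_mixed : forall i l m, l != i -> m != i -> l != m -> db l (db m (Xi i)) = 0
}.

Lemma db_db_b l m i : db l (db m (b i)) = 0.
Proof.
have [->|mi] := eqVneq m i; last by rewrite (db_b_neq mi) raddf0.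
case: i => [|i]; first by rewrite b0 !raddf0.
case: (ltnP i M.+1) => iM; last by rewrite b_out // !raddf0.
by rewrite (db_b (Ordinal iM)) db1.
Qed.

Lemma db_sum l (I : Type) (r : seq I) (Q : pred I) (F : I -> P) :
  db l (\sum_(i <- r | Q i) F i) = \sum_(i <- r | Q i) db l (F i).
Proof. exact: raddf_sum. Qed.
Lemma db_db_sum l m (r : seq nat) (F : nat -> P) :
  (forall k, db l (db m (F k)) = 0) -> db l (db m (\sum_(k <- r) F k)) = 0.
Proof. by move=> h; rewrite (db_sum m) (db_sum l) big1. Qed.
Lemma dbD l f g : db l (f + g) = db l f + db l g. Proof. exact: raddfD. Qed.
Lemma dbB l f g : db l (f - g) = db l f - db l g. Proof. exact: raddfB. Qed.

Lemma afree_sig i : afree (sig i).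
Proof. by apply: afree_sum => k _; apply: afree_b. Qed.

Lemma db_db_sig l m i : db l (db m (sig i)) = 0.
Proof. by apply: db_db_sum => k; apply: db_db_b. Qed.

Definition Xi1 (i : nat) : P := i%:R * b i + sig i.+1.
Definition Xi2 (i : nat) : P := i%:R * b i ^+ 2 + sig i * b i + \sum_(1 <= l < i) b l ^+ 2.

Lemma afree_b2 i k : afree (b i ^+ k).
Proof. by apply: afreeXn; apply: afree_b. Qed.

Lemma db_sqr l (f : P) : db l (f ^+ 2) = f * db l f + f * db l f.
Proof. by rewrite expr2 dbM mulrC. Qed.

Lemma db_db_b2 l m i : l != m -> db l (db m (b i ^+ 2)) = 0.
Proof.
move=> lm; rewrite db_sqr dbD dbM db_db_b mulr0 addr0.
have [li|li] := eqVneq l i; last by rewrite (db_b_neq li) !mul0r addr0.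
by rewrite (@db_b_neq m i) ?mulr0 ?addr0 // -li eq_sym.
Qed.

Lemma db_natM l k (f : P) : db l (k%:R * f) = k%:R * db l f.
Proof. by rewrite dbM db_nat mul0r add0r. Qed.

Lemma Xi1_potential : local_potential Xi1.
Proof.
split=> [i|i l m li mi lm].
  by apply: afreeD; [apply: afreeM; [apply: afreeMn | apply: afree_b] | apply: afree_sig].
by rewrite (dbD m) (dbD l) (db_natM m) (db_natM l) db_db_b db_db_sig mulr0 addr0.
Qed.

Lemma Xi2_potential : local_potential Xi2.
Proof.
split=> [i|i l m li mi lm].
  apply: afreeD; last by apply: afree_sum => k _; apply: afree_b2.
  by apply: afreeD; apply: afreeM;
    [apply: afreeMn | apply: afree_b2 | apply: afree_sig | apply: afree_b].
have db_db_sq k : db l (db m (b k ^+ 2)) = 0 by apply: db_db_b2.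
rewrite 2!(dbD m) 2!(dbD l) (db_natM m) (db_natM l) (db_db_sq i).
rewrite (db_db_sum (index_iota 1 i) db_db_sq).
rewrite (dbM m (sig i)) (db_b_neq mi) !mulr0 !addr0 add0r (dbM l (db m (sig i))).
by rewrite db_db_sig (db_b_neq li); ring.
Qed.

Definition rfield (Xi phi : nat -> P) := log_vf (fun i => Xi i.+1 - Xi i) phi.

Lemma res_nat k : res k%:R = k%:R. Proof. exact: rmorph_nat. Qed.
Lemma res_bE i : res (b i) = b i. Proof. exact: afree_b. Qed.
Lemma res_sigE i : res (sig i) = sig i. Proof. exact: afree_sig. Qed.
Lemma res_exp f k : res (f ^+ k) = res f ^+ k. Proof. exact: rmorphXn. Qed.
Lemma res_1 : res 1 = 1. Proof. exact: rmorph1. Qed.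
Definition resvE := (resD, resB, resN, resM, res_exp, res_nat, res_1, res_a, res_bE, res_sigE).

Lemma res_xi1 : map_mx res xi1 = rfield Xi1 (fun i => b i ^+ 2).
Proof.
rewrite res_log_vf; apply: log_vf_eq => i; rewrite /xi1A /xi1B /Xi1 !resvE; last by ring.
by rewrite (sigS i.+2) (sigS i.+1); ring.
Qed.

Lemma res_xi2 : map_mx res xi2 = rfield Xi2 (fun i => b i ^+ 3).
Proof.
rewrite res_log_vf; apply: log_vf_eq => i; rewrite /xi2A /xi2B /Xi2 !resvE; last by ring.
by rewrite (sigS i.+1) [X in _ = _ + X - _]big_nat_recr //=; ring.
Qed.

Lemma res_chi4 : map_mx res chi4 = rfield (fun i => b i ^+ 2) (fun=> 0).
Proof.
by rewrite res_log_vf; apply: log_vf_eq => i; rewrite /chi4A /chi4B !resvE; ring.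
Qed.

Lemma res_chi5 : map_mx res chi5 = rfield (fun i => b i ^+ 3) (fun=> 0).
Proof.
by rewrite res_log_vf; apply: log_vf_eq => i; rewrite /chi5A /chi5B /cube /cubeo !resvE; ring.
Qed.

(** The bivector pi_j has m = j - 1 and kappa = 1; before normalization, the Lie
  derivative along X1 or X2 multiplies kappa by a scalar. *)
Definition has_nf (kappa : R) (m : nat) (p : 'M[P]_n) : Prop :=
  exists2 G, local_kernel G & map_mx res p = nf G (fun i => kappa%:MP * b i ^+ m).

Lemma afree_x kappa m i : afree (kappa%:MP * b i ^+ m).
Proof. by apply: afreeM; [apply: afreeC | apply: afree_b2]. Qed.

Lemma dbC0 l c : db l c%:MP = 0.
Proof.
case: l => [|l]; first by rewrite db0.
by rewrite db_vb; case: insub => // k; rewrite logdE mderivC mulr0.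
Qed.

Lemma actC0 V c : act logd V c%:MP = 0.
Proof. by rewrite /act big1 // => k _; rewrite logdE mderivC !mulr0. Qed.

Lemma local_x kappa m i l : l != i -> db l (kappa%:MP * b i ^+ m) = 0.
Proof.
move=> li; rewrite dbM dbC0 mul0r add0r; case: m => [|m].
  by rewrite expr0 db1 mulr0.
by rewrite dbXn (db_b_neq li) !mulr0.
Qed.

(** With phi = b^(c+1), the function x = kappa b^m becomes X(x) - x phi' =
  kappa (m - c - 1) b^(m+c). *)
Lemma has_nf_flie c kappa m p X Xi : local_potential Xi ->
  map_mx res X = rfield Xi (fun i => b i ^+ c.+1) -> has_nf kappa m p ->
  has_nf (kappa * (m%:R - c.+1%:R)) (m + c) (flie logd X p).
Proof.
move=> gXi rX [G gG rp]; pose phi i := b i ^+ c.+1; pose Y := rfield Xi phi.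
have bphi i : afree (phi i) by apply: afree_b2.
have lphi i l : l != i -> db l (phi i) = 0.
  by move=> li; rewrite /phi dbXn (db_b_neq li) !mulr0.
have [bXi mXi] := gXi.
pose x i := kappa%:MP * b i ^+ m.
exists (fun i j => act logd Y (G i j) + x j * db j (Xi i) - x i * db i (Xi j)).
  split=> [i j|i j|i j l li lj].
  - by rewrite (kernel_skew gG i j) raddfN /=; ring.
  - apply: afreeD; first apply: afreeD.
    + by apply: afree_act => // ; apply: kernel_afree.
    + by apply: afreeM; [apply: afree_x | apply: afree_db].
    + by apply: afreeN; apply: afreeM; [apply: afree_x | apply: afree_db].
  - have [->|ij] := eqVneq i j.
      by rewrite kernel_diag // raddf0 add0r subrr raddf0.
    have xXi r s : l != r -> l != s -> r != s -> db l (x r * db r (Xi s)) = 0.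
      move=> lr ls rs; rewrite dbM (local_x kappa m lr) mul0r add0r.
      by rewrite (mXi s l r ls rs lr) mulr0.
    have aG : db l (act logd Y (G i j)) = 0.
      rewrite act_afree; last exact: kernel_afree.
      rewrite db_sum big1 // => k _; rewrite dbM dbC (kernel_local gG li lj) raddf0 mulr0 addr0.
      by have [<-|lk] := eqVneq l k.+1; rewrite ?(kernel_local gG li lj) ?mulr0 // lphi ?mul0r.
    by rewrite dbB dbD aG !xXi // 1?eq_sym // subr0 addr0.
rewrite res_flie rX rp (flie_nf gG (afree_x _ _) bXi bphi lphi).
apply: skew_mx_eq => // i j; congr (_ * _); rewrite -/phi -/Y -/(x _).
have Yb : act logd Y (b j.+1) = b j.+1 ^+ c.+1.
  rewrite /Y /rfield act_b //; split=> [|k hk]; rewrite /phi.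
    by rewrite b0 expr0n.
  by rewrite b_out // expr0n.
rewrite /x actMl actC0 mul0r add0r /phi dbXn db_b mulr1.
rewrite mpolyCM mpolyCB !mpolyC_nat.
case: m {rp x} => [|m]; first by rewrite expr0 act1 add0n; ring.
by rewrite actXn Yb addSn -[b j.+1 ^+ (m + c).+1]/(b j.+1 ^+ (m.+1 + c)) exprD !exprS; ring.
Qed.

Lemma kernel_scale (c : R) G : local_kernel G -> local_kernel (fun i j => c%:MP * G i j).
Proof.
move=> gG; split=> [i j|i j|i j l li lj].
- by rewrite (kernel_skew gG i j) mulrN.
- by apply: afreeM; [apply: afreeC | apply: kernel_afree].
- by rewrite dbM dbC0 mul0r (kernel_local gG) // mulr0 addr0.
Qed.

Lemma has_nf_scale c kappa m p : has_nf kappa m p -> has_nf (c * kappa) m (c%:MP *: p).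
Proof.
move=> [G gG rp]; exists (fun i j => c%:MP * G i j); first exact: kernel_scale.
apply/matrixP => k l; rewrite mxE [X in res X]mxE resM [res c%:MP]afreeC.
have -> : res (p k l) = map_mx res p k l by rewrite mxE.
rewrite rp; elim/idx2P: k / l => i j; rewrite !skew_mxE /diff2 ?mpolyCM; ring.
Qed.

Lemma has_nf_toda1 : has_nf 1 0 log_toda1.
Proof.
exists (fun _ _ => 0).
  by split=> *; rewrite ?oppr0 ?raddf0 //; apply: afree0.
rewrite map_skew_mx; last exact: resN.
apply: skew_mx_eq => i j; rewrite ?raddf0 // ?/diff2 ?subrr ?addr0 //.
by rewrite expr0 mulr1 mpolyC1 mulr1 eps_afree.
Qed.

(** * Invariance and compatibility of the hierarchy *)

Lemma chi_va i : chi ord0 (va i) = 'X_(vb (hi i)) - 'X_(vb (lo i)).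
Proof. by rewrite log_vf_va /chiA -!b_vb. Qed.

Lemma aord_a i : aord 1 (a i).
Proof.
case: (ltnP M i) => iM; first by rewrite a_out //; apply: aord0.
case: i iM => [|i] iM; first by rewrite a0; apply: aord0.
by rewrite (a_va (Ordinal iM)); apply: aordXa.
Qed.

Lemma chi_vb k : aord 1 (chi ord0 (vb k)).
Proof.
rewrite log_vf_vb /chiB; apply: aordMl.
by apply: aordB; rewrite expr2; apply: aordMl; apply: aord_a.
Qed.

Lemma diff2_eq0 (F : nat -> nat -> P) i j : (forall r s, F r s = 0) -> diff2 F i j = 0.
Proof. by move=> z; rewrite /diff2 !z !subr0 addr0. Qed.

(** L_psi p is chi-invariant because psi commutes with chi, and on a = 0 it
  vanishes since the potential b_i^k depends on b_i only. *)
Lemma commuting_field_inv psi k kappa m p : br logd chi psi = 0 ->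
  map_mx res psi = rfield (fun i => b i ^+ k) (fun=> 0) ->
  has_nf kappa m p -> flie logd chi p = 0 -> flie logd psi p = 0.
Proof.
move=> comm rpsi [G gG rp] inv; apply: (rigid2 chi_va chi_vb).
  exact: (flie_comm0 logdM logdC).
have b0 : forall i : nat, afree ((fun=> 0) i) by move=> i; apply: afree0.
have bk i : afree (b i ^+ k) by apply: afree_b2.
have l0 i l : l != i -> db l ((fun=> 0) i) = 0 by rewrite raddf0.
rewrite res_flie rpsi rp (flie_nf gG (@afree_x kappa m) bk b0 l0).
rewrite -[RHS]skew_mx0; pose x i : P := kappa%:MP * b i ^+ m.
have bx i : afree (x i) by apply: afree_x.
apply: skew_mx_eq => // i j.
  apply: diff2_eq0 => r s; rewrite act_afree0; last exact: kernel_afree.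
  rewrite add0r; have [->|rs] := eqVneq r s; first by rewrite subrr.
  have sr : s != r by rewrite eq_sym.
  have zk u v : u != v -> db u (b v ^+ k) = 0.
    by move=> uv; have := local_x (1 : R) k uv; rewrite mpolyC1 mul1r.
  by rewrite (zk _ _ sr) (zk _ _ rs) !mulr0 subrr.
by rewrite (act_afree0 _ (bx _)) raddf0 mulr0 subrr mulr0.
Qed.

Lemma flie_preserves_inv psi xi k kappa m p : br logd xi chi = psi -> br logd chi psi = 0 ->
  map_mx res psi = rfield (fun i => b i ^+ k) (fun=> 0) ->
  has_nf kappa m p -> flie logd chi p = 0 -> flie logd chi (flie logd xi p) = 0.
Proof.
move=> brE comm rpsi act_ inv; apply: (flie_flie0 logdM logdC inv).
by rewrite brE; exact: (commuting_field_inv comm rpsi act_ inv).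
Qed.

Lemma logdC0 k c : logd k c%:MP = 0.
Proof. by rewrite logdE mderivC mulr0. Qed.

Fixpoint log_toda (j : nat) : 'M[P]_n :=
  match j with
  | 0 => 0
  | 1 => log_toda1
  | 2 => log_toda2
  | 3 => - flie logd xi1 log_toda2
  | 4 => (- 2%:R^-1)%:MP *: flie logd xi2 log_toda2
  | j'.+1 => ((j'%:R - 3%:R)^-1)%:MP *: flie logd xi1 (log_toda j')
  end.

(** The relation L_X1 pi_j = (j - 3) pi_{j+1} also covers j = 1 and j = 2; it does
  not determine pi_4, which is why X2 is needed. *)
Lemma log_toda_step j : (0 < j)%N -> j != 3%N ->
  log_toda j.+1 = ((j%:R - 3%:R)^-1)%:MP *: flie logd xi1 (log_toda j).
Proof.
case: j => [|[|[|[|j]]]] h0 h3.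
- discriminate h0.
- apply: esym; apply: eq_trans (congr1 (fun A => _ *: A) flie_xi1_toda1) _.
  have -> : (1%:R - 3%:R)^-1 = - 2%:R^-1 :> R by rewrite -invrN; congr _^-1; ring.
  apply/matrixP => i k; rewrite [LHS]mxE [X in _ * X]mxE [X in _ * - X]mxE mpolyCN mulrNN mulrDr.
  exact: halfD.
- have -> : (2%:R - 3%:R)^-1 = -1 :> R.
    have -> : 2%:R - 3%:R = - 1 :> R by ring.
    by rewrite invrN invr1.
  by rewrite mpolyCN mpolyC1 scaleN1r.
- discriminate h3.
- reflexivity.
Qed.

Record toda_level (j : nat) (p : 'M[P]_n) : Prop := TodaLevel {
  level_skew : p^T = - p;
  level_inv : flie logd chi p = 0;
  level_nf : has_nf 1 j.-1 p
}.

(** One step of the induction for either master symmetry xi; psi is [xi, chi]. *)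
Lemma level_step xi psi Xi k c j j' p (s : R) :
  local_potential Xi -> map_mx res xi = rfield Xi (fun i => b i ^+ c.+1) ->
  br logd xi chi = psi -> br logd chi psi = 0 ->
  map_mx res psi = rfield (fun i => b i ^+ k) (fun=> 0) ->
  s * ((j.-1)%:R - c.+1%:R) = 1 -> j'.-1 = (j.-1 + c)%N ->
  toda_level j p -> toda_level j' (s%:MP *: flie logd xi p).
Proof.
move=> gXi rxi brE comm rpsi sE jE [sk inv ad]; split.
- rewrite linearZ /= flie_tr sk raddfN /= scalerN; congr (- _).
- by rewrite (flieZ logdM) => [|l]; rewrite ?logdC0 // (flie_preserves_inv brE comm rpsi ad inv) scaler0.
- have := has_nf_scale s (has_nf_flie gXi rxi ad).
  by rewrite mul1r sE jE.
Qed.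

Lemma log_toda_level j : (0 < j)%N -> toda_level j (log_toda j).
Proof.
have step i : (0 < i)%N -> i != 3%N -> toda_level i (log_toda i) -> toda_level i.+1 (log_toda i.+1).
  move=> i0 i3 ti; rewrite log_toda_step //.
  apply: (level_step Xi1_potential res_xi1 br_xi1_chi
    br_chi_chi4 res_chi4 _ _ ti); last by rewrite addn1 prednK.
  have -> : (i.-1)%:R - 2%:R = i%:R - 3%:R :> R.
    by rewrite -[in RHS](prednK i0) -natr1; ring.
  rewrite mulVf // subr_eq0 eqr_nat //.
have t1 : toda_level 1 (log_toda 1) by split; [exact: log_toda1_skew | exact: flie_chi_toda1 | exact: has_nf_toda1].
have t2 : toda_level 2 (log_toda 2) by apply: step.
have t3 : toda_level 3 (log_toda 3) by apply: step.
have t4 : toda_level 4 (log_toda 4).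
  apply: (level_step Xi2_potential res_xi2 br_xi2_chi
    br_chi_chi5 res_chi5 _ _ t2) => //.
  have -> : (2.-1)%:R - 3%:R = - 2%:R :> R by rewrite /=; ring.
  by rewrite mulrNN mulVf // pnatr_eq0.
case: j => [|[|[|[|j]]]] hj; [discriminate hj | exact: t1 | exact: t2 | exact: t3 |].
elim: j {hj} => [|j IH]; first exact: t4.
exact: step IH.
Qed.

Lemma log_toda_compatible i j k : (0 < i)%N -> (0 < j)%N -> schouten logd (log_toda i) (log_toda j) k = 0.
Proof.
move=> /log_toda_level [si invi [G gG rG]] /log_toda_level [sj invj [G' gG' rG']].
move: k; apply: (rigid3 chi_va chi_vb) => k.
  exact: (flie_schouten logdM logdC).
rewrite res_schouten rG rG'; apply: schouten_nf => // m; try exact: afree_x;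
by move=> l; apply: local_x.
Qed.

(** * Hamiltonians *)

Definition Lax : 'M[P]_M.+1 := jacobi_mx R M.+1.
Definition Ham (j : nat) : P := toda_H R M.+1 j.

Definition jacobi_entry (i k : nat) : P :=
  if i == k then b i.+1 else if k == i.+1 then a i.+1 else if i == k.+1 then a k.+1 else 0.

Lemma LaxE i k : Lax i k = jacobi_entry i k. Proof. by rewrite mxE. Qed.

(** The matrix B of the Lax equation chi(L) = B L - L B. *)
Definition lax_skew : 'M[P]_M.+1 :=
  \matrix_(i, k) ((k == i.+1 :> nat)%:R * a i.+1 - (i == k.+1 :> nat)%:R * a i).

Lemma sum_pick m (F : nat -> P) k :
  \sum_(l < m) (l == k :> nat)%:R * F l = if (k < m)%N then F k else 0.
Proof.
case: ifP => km.
  rewrite (bigD1 (Ordinal km)) //= eqxx mul1r big1 ?addr0 // => l lk.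
  by rewrite (negbTE (lk : (val l != val (Ordinal km)))) mul0r.
rewrite big1 // => l _; case: eqP => [lk|_]; last by rewrite mul0r.
by rewrite -lk ltn_ord in km.
Qed.

Lemma lax_skew_mul (F : nat -> P) (i : 'I_M.+1) :
  \sum_(l < M.+1) lax_skew i l * F l = a i.+1 * F i.+1 - a i * F i.-1.
Proof.
have -> : \sum_(l < M.+1) lax_skew i l * F l =
    \sum_(l < M.+1) (l == i.+1 :> nat)%:R * (a i.+1 * F l)
    - \sum_(l < M.+1) (l == i.-1 :> nat)%:R * (a i * F l).
  rewrite -sumrB; apply: eq_bigr => l _; rewrite mxE mulrBl !mulrA; congr (_ - _ * _).
  case: i => -[|i] hi /=; first by rewrite a0 !mulr0.
  by rewrite eqSS eq_sym.
rewrite (sum_pick _ (fun l => a i.+1 * F l)) (sum_pick _ (fun l => a i * F l)).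
have -> : (i.-1 < M.+1)%N by have := ltn_ord i; lia.
by case: ltnP => // iM; rewrite (a_out iM) mul0r.
Qed.

Lemma mul_lax_skew (F : nat -> P) (k : 'I_M.+1) :
  \sum_(l < M.+1) F l * lax_skew l k = F k.-1 * a k - F k.+1 * a k.+1.
Proof.
have skT l : lax_skew l k = - lax_skew k l.
    by rewrite !mxE opprB; congr (_ - _); case: eqP => [->|_]; rewrite ?mul0r.
transitivity (- \sum_(l < M.+1) lax_skew k l * F l); last by rewrite lax_skew_mul; ring.
by rewrite -sumrN; apply: eq_bigr => l _; rewrite skT; ring.
Qed.

(** Evaluates the comparisons of indices once the offset between them is known. *)
Ltac decide_eqs := repeat match goal with
  | |- context [@eq_op _ ?x ?y] =>
     first [ rewrite (_ : (x == y) = false); last by lia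
           | rewrite (_ : (x == y) = true); last by lia ] end.

Lemma lax : map_mx (act logd chi) Lax = lax_skew *m Lax - Lax *m lax_skew.
Proof.
apply/matrixP => i k; rewrite !mxE.
have -> : \sum_j lax_skew i j * Lax j k = \sum_(l < M.+1) lax_skew i l * jacobi_entry l k.
  by apply: eq_bigr => l _; rewrite LaxE.
have -> : \sum_j Lax i j * lax_skew j k = \sum_(l < M.+1) jacobi_entry i l * lax_skew l k.
  by apply: eq_bigr => l _; rewrite LaxE.
rewrite (lax_skew_mul (fun l => jacobi_entry l k)) (mul_lax_skew (jacobi_entry i)) -/(jacobi_entry i k).
move: (i : nat) (k : nat) => {}i {}k.
rewrite /jacobi_entry.
case: i => [|i]; case: k => [|k]; rewrite ?a0 /=.
- decide_eqs; rewrite act_chi_b /chiB /= a0; ring.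
- case: k => [|[|k]]; decide_eqs; rewrite ?act_a ?raddf0 /chiA; ring.
- case: i => [|[|i]]; decide_eqs; rewrite ?act_a ?raddf0 /chiA; ring.
have [->|ik] := eqVneq i k; first by decide_eqs; rewrite act_chi_b /chiB /=; ring.
have [->|h1] := eqVneq k i.+1; first by decide_eqs; rewrite act_a /chiA /=; ring.
have [->|h2] := eqVneq i k.+1; first by decide_eqs; rewrite act_a /chiA /=; ring.
have [->|h3] := eqVneq k i.+2; first by decide_eqs; rewrite raddf0; ring.
have [->|h4] := eqVneq i k.+2; first by decide_eqs; rewrite raddf0; ring.
by decide_eqs; rewrite raddf0; ring.
Qed.

Lemma chi_H j : act logd chi (Ham j) = 0.
Proof.
have E : map_mx (act logd chi) (Lax ^+ j) = lax_skew *m (Lax ^+ j) - (Lax ^+ j) *m lax_skew.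
  elim: j => [|j IH].
    rewrite expr0 mulmx1 mul1mx subrr; apply/matrixP => i k; rewrite !mxE.
    by rewrite act_nat.
  have alg (A B C : 'M[P]_M.+1) :
      (A *m B - B *m A) *m C + B *m (A *m C - C *m A) = A *m (B *m C) - (B *m C) *m A.
    by rewrite mulmxBl mulmxBr !mulmxA addrA subrK.
  rewrite exprS; apply: eq_trans (map_act_mul logdM _ _ _) _.
  by rewrite lax IH; apply: alg.
rewrite /Ham /toda_H actMl actC0 mul0r add0r.
have -> : act logd chi (\tr (Lax ^+ j)) = \tr (map_mx (act logd chi) (Lax ^+ j)).
  by rewrite /mxtrace raddf_sum; apply: eq_bigr => i _; rewrite [RHS]mxE.
by rewrite E raddfB /= mxtrace_mulC subrr mulr0.
Qed.

(** On a = 0 the Jacobi matrix is diagonal. *)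
Lemma res_LaxX j : map_mx res (Lax ^+ j) = diag_mx (\row_i b i.+1 ^+ j).
Proof.
elim: j => [|j IH].
  by apply/matrixP => i k; rewrite expr0 !mxE rmorph_nat expr0.
rewrite exprS; apply: eq_trans (map_mxM _ _ _) _; rewrite IH mul_mx_diag.
apply/matrixP => i k; rewrite !mxE -/(jacobi_entry i k) /jacobi_entry -val_eqE /=.
have [->|ik] := eqVneq (i : nat) k; first by rewrite res_bE exprS.
by case: ifP => _; [|case: ifP => _]; rewrite ?res_a ?raddf0 mul0r.
Qed.

Lemma res_H j : res (Ham j) = (j%:R^-1)%:MP * \sum_(k < M.+1) b k.+1 ^+ j.
Proof.
rewrite /Ham /toda_H resM [res _%:MP]afreeC; congr (_ * _).
have -> : res (\tr (Lax ^+ j)) = \tr (map_mx res (Lax ^+ j)).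
  by rewrite /mxtrace res_sum; apply: eq_bigr => i _; rewrite [RHS]mxE.
by rewrite res_LaxX mxtrace_diag; apply: eq_bigr => i _; rewrite mxE.
Qed.

Lemma db_res_H (l : 'I_M.+1) j : (0 < j)%N -> db l.+1 (res (Ham j)) = b l.+1 ^+ j.-1.
Proof.
case: j => // j _; rewrite res_H dbM dbC0 mul0r add0r db_sum (bigD1 l) //= big1 => [|k kl].
  have inv : (j.+1%:R^-1)%:MP * j.+1%:R = 1 :> P.
    by rewrite -(@mpolyC_nat n R) -mpolyCM mulVf ?pnatr_eq0 // mpolyC1.
  by rewrite addr0 dbXn db_b mulr1 mulrA inv mul1r.
have lk : l.+1 != k.+1 by rewrite eqSS eq_sym.
by have := local_x (1 : R) j.+1 lk; rewrite mpolyC1 mul1r.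
Qed.

(** Both fields are chi-invariant and agree on a = 0. *)
Lemma ham_sym i j : (0 < i)%N -> (0 < j)%N -> ham logd (log_toda i) (Ham j) = ham logd (log_toda j) (Ham i).
Proof.
move=> i0 j0; apply/eqP; rewrite -subr_eq0; apply/eqP; apply: (rigid1 chi_va chi_vb).
  rewrite brB; have bh r s : (0 < r)%N -> br logd chi (ham logd (log_toda r) (Ham s)) = 0.
    move=> r0; have [_ inv _] := log_toda_level r0.
    exact: (br_ham logdM logdC inv (chi_H s)).
  by rewrite (bh i j i0) (bh j i j0) subrr.
have rh r s (k : 'I_n) : (0 < r)%N -> (0 < s)%N ->
    map_mx res (ham logd (log_toda r) (Ham s)) ord0 k
    = if split k is inl k then b k.+2 ^+ r.-1 * b k.+2 ^+ s.-1 - b k.+1 ^+ r.-1 * b k.+1 ^+ s.-1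
      else 0.
  move=> r0 s0; have [_ _ [G gG rG]] := log_toda_level r0.
  rewrite res_ham rG hamE.
  have bH : afree (res (Ham s)).
    rewrite res_H; apply: afreeM; first exact: afreeC.
    by apply: afree_sum => m _; apply: afree_b2.
  elim/idxP: k => k; rewrite ?split_va ?split_vb ?row_nf_a ?row_nf_b.
    rewrite act_eps // mpolyC1 !mul1r.
    by rewrite (db_res_H (hi k) s0) (db_res_H (lo k) s0).
  by rewrite act_afree0.
rewrite map_mxB; apply/rowP => k; rewrite [LHS]mxE [X in _ + X]mxE [RHS]mxE.
apply/eqP; rewrite subr_eq0; apply/eqP.
rewrite (rh i j k i0 j0) (rh j i k j0 i0); case: split => // l.
by rewrite [b l.+2 ^+ _ * _]mulrC [b l.+1 ^+ _ * _]mulrC.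
Qed.

(** * Change of frame *)

Definition pderiv (k : 'I_n) : {additive P -> P} := mderiv k.
Lemma pderivM k f g : pderiv k (f * g) = pderiv k f * g + f * pderiv k g.
Proof. exact: mderivM. Qed.
Lemma pderivC k l f : pderiv k (pderiv l f) = pderiv l (pderiv k f).
Proof. exact: mderiv_comm. Qed.

Lemma mpoly_two_free (f : P) : f + f = 0 -> f = 0.
Proof.
move/eqP; rewrite -mulr2n -(scaler_nat _ f) scaler_eq0 pnatr_eq0 /=.
by move/eqP.
Qed.

(** From logarithmic components to components in coordinates. *)
Definition vscale (X : 'rV[P]_n) : 'rV[P]_n := \row_k (lscale k * X ord0 k).
Definition mscale (p : 'M[P]_n) : 'M[P]_n := \matrix_(k, l) (lscale k * lscale l * p k l).

Lemma mscale_skew p : p^T = - p -> (mscale p)^T = - mscale p.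
Proof. by move=> pT; apply/matrixP => k l; rewrite !mxE (skewE pT); ring. Qed.

Lemma act_vscale X f : act pderiv (vscale X) f = act logd X f.
Proof. by apply: eq_bigr => k _; rewrite mxE logdE /pderiv /=; ring. Qed.

Lemma act_row_mscale p k f : act pderiv (row k (mscale p)) f = lscale k * act logd (row k p) f.
Proof.
rewrite /act big_distrr; apply: eq_bigr => l _ /=; rewrite !mxE logdE /pderiv /=; ring.
Qed.

Definition is_log (k : 'I_n) : P := (k < M)%N%:R.

Lemma act_scale X k : act logd X (lscale k) = is_log k * lscale k * X ord0 k.
Proof.
rewrite /act (bigD1 k) //= big1 ?addr0 => [|l lk]; rewrite logd_lscale.
  by rewrite eqxx mulrC.
by rewrite (negbTE lk) mul0r mulr0.
Qed.

Lemma flie_mscale X p : p^T = - p -> flie pderiv (vscale X) (mscale p) = mscale (flie logd X p).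
Proof.
move=> pT; apply/matrixP => i j.
rewrite (flie_skewE pderiv (vscale X) i j (mscale_skew pT)) [RHS]mxE (flie_skewE logd X i j pT).
rewrite act_vscale !act_row_mscale !mxE !(actM logdM) !act_scale !mxE (skewE pT j i).
by ring.
Qed.

(** The derivatives of the scale factors contribute terms that cancel in pairs by
  skewness, between the two halves of the symmetric bracket. *)
Lemma schouten_mscale p q k i j : p^T = - p -> q^T = - q ->
  schouten pderiv (mscale p) (mscale q) k i j = lscale k * lscale i * lscale j * schouten logd p q k i j.
Proof.
move=> pT qT.
have E1 := congr2 +%R (flie_skewE pderiv (row k (mscale p)) i j (mscale_skew qT))
                      (flie_skewE pderiv (row k (mscale q)) i j (mscale_skew pT)).
have E2 := congr2 +%R (flie_skewE logd (row k p) i j qT) (flie_skewE logd (row k q) i j pT).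
apply: eq_trans (schoutenE pderiv (mscale p) (mscale q) k i j) _; apply: (eq_trans E1).
apply: eq_trans (congr1 (fun z => lscale k * lscale i * lscale j * z)
  (esym (eq_trans (schoutenE logd p q k i j) E2))) => {E1 E2}.
rewrite !act_row_mscale.
have rE (A : 'M[P]_n) u v : row u A ord0 v = A u v by rewrite mxE.
have mE A u v : mscale A u v = lscale u * lscale v * A u v by rewrite mxE.
rewrite !rE !mE !(actM logdM) !act_scale !rE.
rewrite (skewE pT j i) (skewE qT j i) (skewE pT i k) (skewE qT i k) (skewE pT j k) (skewE qT j k).
by ring.
Qed.

Lemma ham_mscale p f : ham pderiv (mscale p) f = vscale (ham logd p f).
Proof. by apply/rowP => k; rewrite [RHS]mxE !hamE act_row_mscale. Qed.

(** * The hierarchy in coordinates *)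

Lemma lie_pderiv (X : 'rV[P]_n) (p : 'M[P]_n) : lie X p = flie pderiv X p.
Proof.
by apply/matrixP => i j; rewrite [LHS]mxE; apply: esym; apply: flieE.
Qed.

Lemma lscale_va i : lscale (va i) = 'X_(va i).
Proof. by rewrite /lscale [(va i < M)%N](ltn_ord i). Qed.
Lemma lscale_vb i : lscale (vb i) = 1.
Proof. by rewrite /lscale ifF // ltnNge leq_addr. Qed.

Lemma toda_vf_scale (A B A' B' : nat -> P) : (forall i, A i.+1 = a i.+1 * A' i.+1) ->
  (forall i, B i.+1 = B' i.+1) -> @toda_vf R M.+1 A B = vscale (log_vf A' B').
Proof.
move=> hA hB; apply/rowP; elim/idxP => i; rewrite [RHS]mxE ?log_vf_va ?log_vf_vb ?lscale_va ?lscale_vb.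
  by rewrite hA a_va.
by rewrite mul1r hB.
Qed.

Lemma X1_scale : X1 R M.+1 = vscale xi1.
Proof.
apply: toda_vf_scale => i; rewrite /xi1A /xi1B -?/(a _) -?/(b _) //; ring.
Qed.

Lemma X2_scale : X2 R M.+1 = vscale xi2.
Proof.
apply: toda_vf_scale => i; rewrite /xi2A /xi2B /sig -?/(a _) -?/(b _) //; ring.
Qed.

Lemma skew_of_scale (u : 'I_M + 'I_M.+1 -> 'I_M + 'I_M.+1 -> P) aa ab bb :
  (forall i j, u (inl i) (inl j) - u (inl j) (inl i)
     = a i.+1 * a j.+1 * aa i.+1 j.+1) ->
  (forall i j, u (inl i) (inr j) - u (inr j) (inl i) = a i.+1 * ab i.+1 j.+1) ->
  (forall i j, u (inr i) (inr j) - u (inr j) (inr i) = bb i.+1 j.+1) ->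
  @skew_of R M.+1 u = mscale (skew_mx aa ab bb).
Proof.
move=> haa hab hbb; apply/matrixP => k l.
rewrite [LHS](_ : _ = u (split k) (split l) - u (split l) (split k)); last by rewrite mxE.
rewrite [RHS](_ : _ = lscale k * lscale l * skew_mx aa ab bb k l); last by rewrite mxE.
elim/idx2P: k / l => i j.
- by rewrite !split_va skew_mxE !lscale_va -!a_va haa.
- by rewrite split_va split_vb skew_mxE lscale_va lscale_vb -!a_va hab mulr1.
- by rewrite split_va split_vb skew_mxE lscale_va lscale_vb -!a_va -opprB hab mul1r mulrN.
- by rewrite !split_vb skew_mxE !lscale_vb hbb !mul1r.
Qed.

Lemma toda1_scale : toda1 R M.+1 = mscale log_toda1.
Proof.
apply: skew_of_scale => i j; rewrite ?subrr ?mulr0 // subr0 -!/(a _) /eps !eqSS.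
have [->|ji] := eqVneq (j : nat) i; first by rewrite neq_succ /=; ring.
by case: ifP => _ /=; ring.
Qed.

Lemma toda2_scale : toda2 R M.+1 = mscale log_toda2.
Proof.
apply: skew_of_scale => i j; rewrite ?subr0 -!/(a _) -?/(b _) -?/half !eqSS.
- move: (i : nat) (j : nat) => {}i {}j.
  have [->|ji] := eqVneq j i.+1; first by rewrite !neq_succ /=; ring.
  have [->|ij] := eqVneq i j.+1; first by rewrite /=; ring.
  by rewrite /=; ring.
- move: (i : nat) (j : nat) => {}i {}j.
  have [->|ji] := eqVneq j i; first by rewrite neq_succ /=; ring.
  by case: ifP => _ /=; ring.
- move: (i : nat) (j : nat) => {}i {}j.
  have [->|ji] := eqVneq j i.+1; first by rewrite !neq_succ /=; ring.
  have [->|ij] := eqVneq i j.+1; first by rewrite /=; ring.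
  by rewrite /=; ring.
Qed.

Lemma mscaleZ c p : mscale (c *: p) = c *: mscale p.
Proof. by apply/matrixP => k l; rewrite !mxE; ring. Qed.
Lemma mscaleN p : mscale (- p) = - mscale p.
Proof. by apply/matrixP => k l; rewrite !mxE; ring. Qed.

Lemma lie_scale X p : p^T = - p -> lie (vscale X) (mscale p) = mscale (flie logd X p).
Proof. by move=> pT; rewrite lie_pderiv flie_mscale. Qed.

Lemma toda_scale j : (0 < j)%N -> toda R M.+1 j = mscale (log_toda j).
Proof.
have skew i : (0 < i)%N -> (log_toda i)^T = - log_toda i by move=> i0; case: (log_toda_level i0).
case: j => [|[|[|[|j]]]] hj; [discriminate hj | exact: toda1_scale | exact: toda2_scale | |].
  apply: eq_trans (congr1 -%R (congr2 (@lie _ _) X1_scale toda2_scale)) _.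
  by rewrite (lie_scale _ (skew 2 isT)) -mscaleN.
elim: j {hj} => [|j IH].
  apply: eq_trans (congr1 ( *:%R _) (congr2 (@lie _ _) X2_scale toda2_scale)) _.
  by rewrite (lie_scale _ (skew 2 isT)) -mscaleZ.
apply: eq_trans (congr1 ( *:%R _) (congr2 (@lie _ _) X1_scale IH)) _.
by rewrite (lie_scale _ (skew j.+4 isT)) -mscaleZ.
Qed.

Lemma toda_Y_modular j : (0 < j)%N -> toda_Y R M.+1 j = modular pderiv (mscale (log_toda j)).
Proof. by move=> j0; rewrite -toda_scale. Qed.

Lemma toda_modular i j : (0 < i)%N -> (0 < j)%N ->
  vf_apply (toda_Y R M.+1 i) (toda_H R M.+1 j) = vf_apply (toda_Y R M.+1 j) (toda_H R M.+1 i)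
  /\ lie (toda_Y R M.+1 i) (toda R M.+1 j) = - lie (toda_Y R M.+1 j) (toda R M.+1 i).
Proof.
move=> i0 j0; have sk k : (0 < k)%N -> (log_toda k)^T = - log_toda k.
  by move=> k0; case: (log_toda_level k0).
have sks k : (0 < k)%N -> (mscale (log_toda k))^T = - mscale (log_toda k).
  by move=> k0; apply/mscale_skew/sk.
rewrite !toda_Y_modular // !toda_scale //; split.
  have Y k l : (0 < k)%N -> vf_apply (modular pderiv (mscale (log_toda k))) (toda_H R M.+1 l)
      = - \sum_m pderiv m (vscale (ham logd (log_toda k) (Ham l)) ord0 m).
    move=> k0; rewrite -ham_mscale.
    exact: (act_modular pderivM pderivC mpoly_two_free _ (sks k k0)).
  by rewrite (Y i j i0) (Y j i j0) (ham_sym i0 j0).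
apply/eqP; rewrite -addr_eq0; apply/eqP; rewrite !lie_pderiv.
apply: eq_trans (flie_modular pderivM pderivC mpoly_two_free (sks i i0) (sks j j0)) _.
apply/matrixP => k l; rewrite 2!mxE [RHS]mxE big1 ?oppr0 // => c _.
rewrite schouten_mscale; [|exact: sk|exact: sk].
by rewrite log_toda_compatible // [X in _ * X]mxE mulr0 raddf0.
Qed.

End Toda.

Theorem corollary1 (R : realType) (N : nat) (hN : (2 <= N)%N) (i j : nat)
    (hi : (1 <= i)%N) (hj : (1 <= j)%N) :
  vf_apply (toda_Y R N i) (toda_H R N j) = vf_apply (toda_Y R N j) (toda_H R N i)
  /\ lie (toda_Y R N i) (toda R N j) = - lie (toda_Y R N j) (toda R N i).
Proof.
case: N hN => // M _; exact: (toda_modular R M hi hj).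
Qed.
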